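(* Let $X \subset \mathbb{P}^3_{\mathbb{C}}$ be a smooth surface of degree $d \geq 4$, and let $\mathcal{L}$ be a connected configuration of $k \geq 2$ lines on $X$. Then $$h(X; \mathcal{L}) \geq -d(d-1).$$
   Context: A configuration $\mathcal{L}$ of lines on $X$ is a finite set of distinct lines of $\mathbb{P}^3_{\mathbb{C}}$ contained in $X$; it is connected if the union of its lines is connected as a subset of $\mathbb{P}^3_{\mathbb{C}}$. $t_r$ denotes the number of points of $X$ lying on exactly $r$ lines of $\mathcal{L}$. Writing $L$ for the divisor on $X$ which is the sum of the lines in $\mathcal{L}$, the (local) H-constant is $$h(X;\mathcal{L}) = \frac{L^2 - \sum_{r\ge 2} r^2 t_r}{\sum_{r \geq 2} t_r},$$ where $L^2$ is the self-intersection number on $X$. *)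

(* Defs.v *)
(* mpoly must be imported before the mathcomp-analysis files: in the other
   order the two notation levels clash. *)
From HB Require Import structures.
From mathcomp Require Import all_boot all_order all_algebra complex finmap.
From mathcomp Require Import freeg mpoly.
From mathcomp Require Import all_classical all_reals topology.

Set Implicit Arguments.
Unset Strict Implicit.
Unset Printing Implicit Defensive.

Import Order.TTheory GRing.Theory Num.Theory.
Local Open Scope ring_scope.
Local Open Scope complex_scope.
Local Open Scope classical_set_scope.

(* For R : realType, R[i] is the field of complex numbers. Points and lines of
   P^3 are the linear subspaces of dimension 1 and 2 of C^4, and
   incidence is inclusion of subspaces. *)
Definition proj_point (R : realType) : Type :=
  {p : {vspace 'rV[R[i]]_4} | \dim p == 1%N}.
HB.instance Definition _ (R : realType) :=
  Choice.copy (proj_point R) {p : {vspace 'rV[R[i]]_4} | \dim p == 1%N}.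

Definition proj_line (R : realType) : Type :=
  {l : {vspace 'rV[R[i]]_4} | \dim l == 2%N}.
HB.instance Definition _ (R : realType) :=
  Choice.copy (proj_line R) {l : {vspace 'rV[R[i]]_4} | \dim l == 2%N}.

Definition incident (R : realType) (p : proj_point R) (l : proj_line R) :
    bool :=
  (sval p <= sval l)%VS.

(* The polynomial f vanishes on the affine cone V; for homogeneous f this means
   that f vanishes on the projective subspace of V. *)
Definition vanishes (R : realType) (f : {mpoly R[i][4]})
    (V : {vspace 'rV[R[i]]_4}) : Prop :=
  forall v, v \in V -> f.@[v 0] = 0.

(* The Zariski topology on P^3: the sets D(f), f homogeneous, form a subbase
   (even a base) of open sets. *)
Definition zariski_basic (R : realType) : set (set (proj_point R)) :=
  [set U | exists (n : nat) (f : {mpoly R[i][4]}),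
     f \is n.-homog /\ U = [set p | ~ vanishes f (sval p)]].
HB.instance Definition _ (R : realType) :=
  isSubBaseTopological.Build (proj_point R) (@zariski_basic R) id.

(* X is the zero locus of the form F; the Jacobian criterion on all of X also
   forces F to be nonzero and reduced, so that d is the degree of X. *)
Definition smooth_surface (R : realType) (d : nat) (F : {mpoly R[i][4]}) :
    Prop :=
  F \is d.-homog /\
  forall v : 'rV[R[i]]_4, v != 0 -> F.@[v 0] = 0 ->
    exists i : 'I_4, F^`M(i).@[v 0] != 0.

Definition line_config (R : realType) (F : {mpoly R[i][4]})
    (L : {fset proj_line R}) : Prop :=
  forall l, l \in L -> vanishes F (sval l).

Definition config_support (R : realType) (L : {fset proj_line R}) :
    set (proj_point R) :=
  [set p | exists2 l, l \in L & incident p l].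

Definition connected_config (R : realType) (L : {fset proj_line R}) : Prop :=
  connected (config_support L).

(* The cardinal of an infinite set is junk (0) here; when r >= 2 the set is
   finite. *)
Definition t_ (R : realType) (F : {mpoly R[i][4]}) (L : {fset proj_line R})
    (r : nat) : nat :=
  #|` fset_set [set p : proj_point R | vanishes F (sval p) /\
                  #|` [fset l in L | incident p l]%fset| = r] |.

Definition ideal_gen (S : nzRingType) (A : set S) : set S :=
  [set f | exists2 s : seq (S * S),
     (forall u, u \in s -> A u.2) & f = \sum_(u <- s) u.1 * u.2].

Definition line_ideal (R : realType) (l : proj_line R) :
    set {mpoly R[i][4]} :=
  [set f | vanishes f (sval l)].

(* The subspace of V whose set of elements is A, when A is a linear subspace;
   it is 0 when there is no such subspace. *)
Definition subspace_of (K : fieldType) (V : vectType K) (A : set V) :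
    {vspace V} :=
  xget 0%VS [set U : {vspace V} | forall v, v \in U <-> A v].

(* dim (C[x_0..x_3] / I)_n, for a homogeneous ideal I *)
Definition hilbert_function (R : realType) (I : set {mpoly R[i][4]})
    (n : nat) : nat :=
  (\dim {: dhomog 4 R[i] n}
   - \dim (subspace_of [set f : dhomog 4 R[i] n | I (f : {mpoly R[i][4]})]))%N.

Definition hilbert_poly (R : realType) (I : set {mpoly R[i][4]}) :
    {poly rat} :=
  xget 0 [set P : {poly rat} | exists N : nat, forall n : nat, (N <= n)%N ->
            P.[n%:R] = (hilbert_function I n)%:R].

(* chi(O_Z) for the closed subscheme Z of P^3 defined by I: by Serre
   chi(O_Z(n)) is the value at n of the Hilbert polynomial of Z. *)
Definition chi_struct (R : realType) (I : set {mpoly R[i][4]}) : rat :=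
  (hilbert_poly I).[0].

(* chi(O_X(-C)), where X is defined by F and the curve C on X by the ideal I
   containing F: O_X(-C) is the kernel of O_X -> O_C. *)
Definition chi_minus (R : realType) (F : {mpoly R[i][4]})
    (I : set {mpoly R[i][4]}) : rat :=
  chi_struct (ideal_gen [set F]) - chi_struct I.

(* The ideal sheaf O_X(-C-D) on X is the product of O_X(-C) and O_X(-D). *)
Definition sum_ideal (R : realType) (F : {mpoly R[i][4]})
    (I J : set {mpoly R[i][4]}) : set {mpoly R[i][4]} :=
  ideal_gen ([set h | exists f g, [/\ I f, J g & h = f * g]] `|` [set F]).

(* C.D = chi(O_X) - chi(O_X(-C)) - chi(O_X(-D)) + chi(O_X(-C-D)), for curves
   C and D on the smooth surface X, possibly with common components. *)
Definition curve_int (R : realType) (F : {mpoly R[i][4]})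
    (I J : set {mpoly R[i][4]}) : rat :=
  chi_struct (ideal_gen [set F]) - chi_minus F I - chi_minus F J
  + chi_minus F (sum_ideal F I J).

(* The intersection number on X of divisors, i.e. formal integral sums of prime
   divisors, by bilinearity; only divisors supported on lines are needed. *)
Definition intersection_number (R : realType) (F : {mpoly R[i][4]})
    (D E : {freeg (proj_line R) / int}) : rat :=
  \sum_(l <- dom D) \sum_(m <- dom E)
    (coeff l D * coeff m E)%:~R * curve_int F (line_ideal l) (line_ideal m).

Definition config_divisor (R : realType) (L : {fset proj_line R}) :
    {freeg (proj_line R) / int} :=
  \sum_(l <- L) << l >>.

(* t_r = 0 for r > #|L|, so these are the sums over all r >= 2. *)
Definition h_constant (R : realType) (F : {mpoly R[i][4]})
    (L : {fset proj_line R}) : rat :=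
  (intersection_number F (config_divisor L) (config_divisor L)
   - \sum_(2 <= r < #|` L|.+1) (r ^ 2 * t_ F L r)%:R)
  / \sum_(2 <= r < #|` L|.+1) (t_ F L r)%:R.

(* Main.v *)
(* With s = sum of t_r over r >= 2 and M = sum of r t_r, adjunction on X (l^2 = 2 - d)
   gives L^2 - sum of r^2 t_r = k (2 - d) - M. By connectedness every line carries
   a multiple point, so k <= M. Lines of X through p lie in the tangent plane at p,
   and more than d of them would force that plane into X, which smoothness excludes;
   so M <= d s, and k (d - 2) + M <= (d - 1) M <= d (d - 1) s.

   The intersection numbers are Hilbert polynomial computations: with I, J the
   ideals of two lines l, m, C.D = 2 - P(0), where P is the Hilbert polynomial of
   S / (IJ + (F)), and multiplication by F gives
     HF(S / (IJ + (F)))(n) = HF(S / IJ)(n) - HF(S / (IJ : F))(n - d).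
   In coordinates adapted to l and m, IJ is a monomial ideal, and in positive
   degrees (IJ : F) consists of the forms vanishing on the intersection of l and m:
   if gF is in IJ, its differential g dF vanishes there, whereas dF does not. *)
Require Import Defs.
From HB Require Import structures.
From mathcomp Require Import all_boot all_order all_algebra complex finmap.
From mathcomp Require Import freeg mpoly.
From mathcomp Require Import all_classical all_reals topology.
From mathcomp Require Import zify ring lra.

Set Implicit Arguments.
Unset Strict Implicit.
Unset Printing Implicit Defensive.

Import Order.TTheory GRing.Theory Num.Theory.
Local Open Scope ring_scope.
Local Open Scope complex_scope.

Lemma coefM_top (K : comNzRingType) (p q : {poly K}) (i j : nat) :
  (size p <= i.+1)%N -> (size q <= j.+1)%N -> (p * q)`_(i + j) = p`_i * q`_j.
Proof.
move=> hp hq; rewrite coefM.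
rewrite (bigD1 (inord i)) //= big1 ?addr0 => [|k hk].
  by rewrite inordK ?addKn // ltnS leq_addr.
have [lt_ki|lt_ik|eq_ki] := ltngtP k i.
- by rewrite [q`__]nth_default ?mulr0 //; apply: leq_trans hq _; lia.
- by rewrite [p`__]nth_default ?mul0r //; apply: leq_trans hp _; lia.
- by case/negP: hk; apply/eqP/val_inj; rewrite /= eq_ki inordK // ltnS leq_addr.
Qed.

(* The restriction of f to the parametrized line t |-> u + t v. *)
Definition line_poly (K : comNzRingType) (n : nat) (u v : 'rV[K]_n)
    (f : {mpoly K[n]}) : {poly K} :=
  mmap polyC (fun i => (u 0 i)%:P + v 0 i *: 'X) f.

HB.instance Definition _ (K : comNzRingType) n (u v : 'rV[K]_n) :=
  GRing.isZmodMorphism.Build {mpoly K[n]} {poly K} (line_poly u v)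
    (mmap_is_additive (fun i => (u 0 i)%:P + v 0 i *: 'X)
       (@polyC K : {additive _ -> _})).
HB.instance Definition _ (K : comNzRingType) n (u v : 'rV[K]_n) :=
  GRing.isMultiplicative.Build {mpoly K[n]} {poly K} (line_poly u v)
    (mmap_is_multiplicative (fun i => (u 0 i)%:P + v 0 i *: 'X)
       (@polyC K : {rmorphism _ -> _})).

Lemma line_polyX (K : comNzRingType) n (u v : 'rV[K]_n) i :
  line_poly u v 'X_i = (u 0 i)%:P + v 0 i *: 'X.
Proof. by rewrite /line_poly mmapX mmap1U. Qed.

Lemma line_polyZ (K : comNzRingType) n (u v : 'rV[K]_n) c f :
  line_poly u v (c *: f) = c *: line_poly u v f.
Proof. by rewrite /line_poly mmapZ /= mul_polyC. Qed.

Lemma horner_line_poly (K : comNzRingType) n (u v : 'rV[K]_n) f (t : K) :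
  (line_poly u v f).[t] = f.@[(u + t *: v) 0].
Proof.
rewrite /line_poly mevalE /mmap -horner_evalE raddf_sum /=.
apply: eq_bigr => m _; rewrite horner_evalE hornerM hornerC; congr (_ * _).
rewrite /mmap1 -horner_evalE rmorph_prod /=; apply: eq_bigr => i _.
by rewrite rmorphXn /= !horner_evalE !hornerE !mxE mulrC.
Qed.

Lemma line_poly_top (K : comNzRingType) n (u v : 'rV[K]_n) f d :
  f \is d.-homog ->
  (size (line_poly u v f) <= d.+1)%N /\ (line_poly u v f)`_d = f.@[v 0].
Proof.
move=> /dhomogP hf.
have mon (m : 'X_{1..n}) (h : 'I_n -> {poly K}) :
    h = (fun i => (u 0 i)%:P + v 0 i *: 'X) ->
    (size (mmap1 h m) <= (mdeg m).+1)%N /\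
    (mmap1 h m)`_(mdeg m) = \prod_i (v 0 i) ^+ m i.
  move=> hE; rewrite /mmap1 mdegE.
  pose Q k (p : {poly K}) c := (size p <= k.+1)%N /\ p`_k = c.
  have QM k k' p p' c c' : Q k p c -> Q k' p' c' -> Q (k + k')%N (p * p') (c * c').
    move=> [h1 h2] [h1' h2']; split; last by rewrite coefM_top // h2 h2'.
    by apply: leq_trans (size_polyMleq _ _) _; lia.
  have Q1 : Q 0%N 1 1 by split; rewrite ?size_poly1 // coef1.
  have Qlin i : Q 1%N (h i) (v 0 i).
    rewrite hE; split; last by rewrite coefD coefC coefZ coefX /= add0r mulr1.
    rewrite (leq_trans (size_polyD _ _)) // geq_max.
    rewrite (leq_trans (size_polyC_leq1 _)) //=.
    by rewrite (leq_trans (size_scale_leq _ _)) ?size_polyX.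
  apply: (big_rec3 Q) => // i k p c _ Qkp; apply: (QM) => //.
  elim: (m i) => [|e ihe]; first exact: Q1.
  by rewrite !exprS -add1n; apply: (QM).
have fE : line_poly u v f = \sum_(m <- msupp f)
    f@_m *: mmap1 (fun i => (u 0 i)%:P + v 0 i *: 'X) m.
  by apply: eq_bigr => m _; rewrite mul_polyC.
rewrite fE; split.
  rewrite big_seq; elim/big_ind: _ => [|p q hp hq|m /hf hm].
  - by rewrite size_poly0.
  - by rewrite (leq_trans (size_polyD _ _)) // geq_max hp hq.
  - rewrite -hm; apply: leq_trans (size_scale_leq _ _) _.
    by have [] := mon m _ erefl.
rewrite coef_sum mevalE big_seq [RHS]big_seq; apply: eq_bigr => m /hf hm.
by rewrite coefZ -hm; have [_ ->] := mon m _ erefl.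
Qed.

Lemma deriv_line_poly (K : comNzRingType) n (u v : 'rV[K]_n) f :
  (line_poly u v f)^`() = \sum_i v 0 i *: line_poly u v f^`M(i).
Proof.
pose P f := (line_poly u v f)^`() = \sum_i v 0 i *: line_poly u v f^`M(i).
have PM p q : P p -> P q -> P (p * q).
  rewrite /P rmorphM derivM => -> ->.
  rewrite mulr_suml mulr_sumr -big_split; apply: eq_bigr => i _ /=.
  by rewrite mderivM rmorphD !rmorphM /= scalerDr scalerAl scalerAr.
have P1 : P 1.
  rewrite /P rmorph1 -polyC1 derivC big1 // => i _.
  by rewrite -mpolyC1 mderivC rmorph0 scaler0.
have PX i : P 'X_i.
  rewrite /P line_polyX derivD derivC derivZ derivX add0r.
  rewrite (bigD1 i) //= big1 => [|j hj].
    rewrite addr0 mderivX mnm1E eqxx scale1r; congr (_ *: _).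
    have -> : (U_(i) - U_(i))%MM = 0%MM :> 'X_{1..n}.
      by apply/mnmP => k; rewrite mnmBE subnn mnm0E.
    by rewrite mpolyX0 rmorph1.
  by rewrite mderivX mnm1E eq_sym (negbTE hj) scale0r rmorph0 scaler0.
have P0 : P 0.
  by rewrite /P rmorph0 deriv0 big1 // => i _; rewrite mderiv0 rmorph0 scaler0.
elim/mpolyind: f => [|c m p _ _ Pp]; first exact: P0.
have Pm : P 'X_[m].
  rewrite mpolyXE_id; elim/big_ind: _ => // i _.
  by elim: (m i) => [|e ihe]; rewrite ?expr0 // exprS; apply: (PM).
rewrite rmorphD /= line_polyZ derivD derivZ Pm Pp scaler_sumr -big_split.
apply: eq_bigr => i _ /=.
by rewrite mderivD mderivZ rmorphD /= line_polyZ scalerDr !scalerA mulrC.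
Qed.

Lemma poly_eq0_horner (K : numDomainType) (p : {poly K}) :
  (forall t, p.[t] = 0) -> p = 0.
Proof.
move=> p0; apply/eqP; apply: contraT => p_neq0.
have := max_poly_roots p_neq0 (rs := [seq k%:R | k <- iota 0 (size p)]).
rewrite size_map size_iota ltnn => -> //.
  by apply/allP => t _; rewrite /root p0.
by rewrite map_inj_uniq ?iota_uniq //; apply: mulrIn; rewrite oner_neq0.
Qed.

Lemma eval_deriv_eq0 (K : numDomainType) n (f : {mpoly K[n]}) (u v : 'rV[K]_n) :
  (forall t, f.@[(u + t *: v) 0] = 0) ->
  \sum_i v 0 i * f^`M(i).@[u 0] = 0.
Proof.
move=> f0.
have /(congr1 (fun p : {poly K} => p^`().[0])) : line_poly u v f = 0.
  by apply: poly_eq0_horner => t; rewrite horner_line_poly f0.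
rewrite /= deriv_line_poly deriv0 horner0 horner_sum => h; rewrite -[RHS]h.
apply: eq_bigr => i _; rewrite hornerZ horner_line_poly; congr (_ * _).
by apply: meval_eq => j; rewrite scale0r addr0.
Qed.

(* Induction on the degree of m: f vanishes along a coordinate subspace, hence so
   do its derivatives in the directions of that subspace. *)
Lemma coord_vanish_coef0 (K : numDomainType) n (A : pred 'I_n)
    (f : {mpoly K[n]}) (m : 'X_{1..n}) :
  (forall y : 'rV[K]_n, (forall i, A i -> y 0 i = 0) -> f.@[y 0] = 0) ->
  (forall i, A i -> m i = 0%N) -> f@_m = 0.
Proof.
elim: {m}(mdeg m) {-2}m (erefl (mdeg m)) f => [|e ihe] m hm f hf hA.
  move/eqP: hm; rewrite mdeg_eq0 => /eqP ->.
  have := hf 0; rewrite mevalE => <-; last by move=> i _; rewrite mxE.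
  rewrite (bigID (pred1 0%MM)) /= [X in _ + X]big1 ?addr0 => [|k k_neq0].
    have [h|h] := boolP (0%MM \in msupp f).
      rewrite -big_filter filter_pred1_uniq // big_seq1 big1 ?mulr1 // => i _.
      by rewrite mnm0E.
    rewrite memN_msupp_eq0 // big1_seq // => k /andP[/eqP -> h'].
    by rewrite h' in h.
  apply/eqP; rewrite mulf_eq0; apply/orP; right.
  have [i hi] : exists i, k i != 0%N.
    apply/existsP; apply: contraNT k_neq0.
    rewrite negb_exists => /forallP hk.
    by rewrite /= -mdeg_eq0 mdegE sum_nat_eq0; apply/forallP => i; have := hk i; rewrite negbK.
  by rewrite (bigD1 i) //= mxE expr0n (negbTE hi) mul0r.
have [i hi] : exists i, m i != 0%N.
  apply/existsP; apply: contra_eqT hm; rewrite negb_exists => /forallP hk.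
  by rewrite mdegE big1 // => i _; apply/eqP; have := hk i; rewrite negbK.
have iA : ~~ A i by apply/negP => /hA h; rewrite h in hi.
have mE : (m - U_(i) + U_(i))%MM = m by apply: submK; rewrite lep1mP.
have : f^`M(i)@_(m - U_(i)) = 0.
  apply: ihe => [|y hy|j Aj]; last by rewrite mnmBE hA.
    by have := congr1 (@mdeg n) mE; rewrite mdegD mdeg1 hm; lia.
  have := @eval_deriv_eq0 _ _ f y (delta_mx 0 i).
  rewrite (bigD1 i) //= big1 => [|j hj]; last by rewrite mxE (negbTE hj) andbF mul0r.
  rewrite mxE !eqxx mul1r addr0; apply => t; apply: hf => j Aj.
  rewrite !mxE hy // eqxx; case: eqP => [ji|_]; last by rewrite mulr0 addr0.
  by rewrite -ji Aj in iA.
by rewrite mcoeff_deriv mE => /eqP; rewrite mulrn_eq0 => /eqP.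
Qed.

Lemma dhomog_deriv (K : comNzRingType) n (f : {mpoly K[n]}) d i :
  f \is d.-homog -> f^`M(i) \is d.-1.-homog.
Proof.
move=> /dhomogP hf; apply/dhomogP => m; rewrite mcoeff_msupp mcoeff_deriv => h.
suff /hf : (m + U_(i))%MM \in msupp f by rewrite /= mdegD mdeg1 addn1 => <-.
by rewrite mcoeff_msupp; apply: contraNneq h => ->; rewrite mul0rn.
Qed.

Lemma dhomog_evalZ (K : comNzRingType) n (f : {mpoly K[n]}) d c (x : 'rV[K]_n) :
  f \is d.-homog -> f.@[(c *: x) 0] = c ^+ d * f.@[x 0].
Proof.
move=> /dhomogP hf; rewrite !mevalE mulr_sumr big_seq [RHS]big_seq.
apply: eq_bigr => m /hf /= <-; rewrite mulrCA; congr (_ * _).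
rewrite mdegE -prodrXr -big_split; apply: eq_bigr => i _ /=.
by rewrite mxE exprMn.
Qed.

Lemma pencil_root (K : closedFieldType) n (g : {mpoly K[n]}) e (a b : 'rV[K]_n) :
  g \is e.+1.-homog -> (exists t, g.@[(a + t *: b) 0] = 0) \/ g.@[b 0] = 0.
Proof.
move=> hg; have [hs htop] := line_poly_top a b hg.
have [h|h] := boolP (size (line_poly a b g) == 1%N).
  by right; rewrite -htop nth_default // (eqP h).
by left; have [t /rootP] := closed_rootP _ h; rewrite horner_line_poly; exists t.
Qed.

Definition diff_at (K : fieldType) n (f : {mpoly K[n]}) (w : 'rV[K]_n) :
  'rV[K]_n -> K^o := fun x => \sum_i x 0 i * f^`M(i).@[w 0].

Lemma diff_at_is_linear (K : fieldType) n (f : {mpoly K[n]}) w :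
  linear (diff_at f w).
Proof.
move=> c x y; rewrite /diff_at scaler_sumr -big_split; apply: eq_bigr => i _ /=.
by rewrite !mxE mulrDl -mulrA.
Qed.
HB.instance Definition _ (K : fieldType) n (f : {mpoly K[n]}) w :=
  GRing.isLinear.Build K 'rV[K]_n K^o *:%R (diff_at f w)
    (diff_at_is_linear f w).

Lemma diff_at_delta (K : fieldType) n (f : {mpoly K[n]}) w i :
  diff_at f w (delta_mx 0 i) = f^`M(i).@[w 0].
Proof.
rewrite /diff_at (bigD1 i) //= mxE !eqxx mul1r big1 ?addr0 // => j hj.
by rewrite mxE (negbTE hj) andbF mul0r.
Qed.

Lemma diff_at_vanishes (R : realType) (F : {mpoly R[i][4]}) U (w x : 'rV[R[i]]_4) :
  vanishes F U -> w \in U -> x \in U -> diff_at F w x = 0.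
Proof.
by move=> FU wU xU; apply: eval_deriv_eq0 => t; apply: FU; rewrite memvD ?memvZ.
Qed.

Lemma memvNP (K : fieldType) (V : vectType K) (U W : {vspace V}) :
  ~~ (U <= W)%VS -> exists2 x, x \in U & x \notin W.
Proof.
move=> /subvP h; apply/exists2P; apply: contrapT => hn; apply: h => x xU.
by apply: contrapT => /negP xW; apply: hn; exists x.
Qed.

Lemma hyperplane_not_in_smooth (R : realType) d (F : {mpoly R[i][4]})
    (T : {vspace 'rV[R[i]]_4}) :
  (2 <= d)%N -> smooth_surface d F -> \dim T = 3%N -> ~ vanishes F T.
Proof.
case: d => [//|[//|d]] _ [homF smF] dimT FT.
have dim4 : \dim {: 'rV[R[i]]_4} = 4%N by rewrite dimvf.
have [e _ eT] : exists2 e, e \in fullv & e \notin T.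
  by apply: memvNP; apply: contraL (isT) => /dimvS; rewrite dim4 dimT.
have [a aT a0] : exists2 a, a \in T & a \notin 0%VS.
  by apply: memvNP; apply: contraL (isT) => /dimvS; rewrite dimv0 dimT.
have [b bT ba] : exists2 b, b \in T & b \notin <[a]>%VS.
  by apply: memvNP; apply: contraL (isT) => /dimvS; rewrite dimT dim_vline; case: eqP.
rewrite memv0 in a0.
pose g := \sum_i e 0 i *: F^`M(i).
have homg : g \is d.+1.-homog.
  by apply: rpred_sum => i _; apply: dhomogZ; apply: dhomog_deriv homF.
have [w [wT w0 gw]] : exists w, [/\ w \in T, w != 0 & g.@[w 0] = 0].
  have [[t ht]|hb] := pencil_root b a homg.
    exists (b + t *: a); split => //; first by rewrite memvD ?memvZ.
    apply: contraNneq ba => /eqP; rewrite addr_eq0 => /eqP ->.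
    by rewrite memvN memvZ // memv_line.
  by exists a.
have [i /eqP[]] := smF w w0 (FT w wT).
rewrite -diff_at_delta.
have : delta_mx 0 i \in (T + <[e]>)%VS.
  suff -> : (T + <[e]>)%VS = fullv by rewrite memvf.
  apply/eqP; rewrite eqEdim subvf dim4 dimv_disjoint_sum ?dimT ?dim_vline.
    by case: eqP eT => // ->; rewrite mem0v.
  apply/eqP; rewrite -subv0; apply/subvP => x /memv_capP[xT /vlineP[c xE]].
  rewrite memv0 xE scaler_eq0; have [//|c0] := eqVneq c 0.
  case/negP: eT; rewrite -[e]scale1r -(mulVf c0) -scalerA -xE.
  by rewrite memvZ.
move=> /memv_addP[y yT [z /vlineP[c ->] ->]].
rewrite linearD linearZ /= (diff_at_vanishes FT) // add0r.
suff -> : diff_at F w e = 0 by rewrite scaler0.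
by rewrite -gw raddf_sum /=; apply: eq_bigr => j _; rewrite mevalZ.
Qed.

Lemma dim_tangent (R : realType) d (F : {mpoly R[i][4]}) (v : 'rV[R[i]]_4) :
  smooth_surface d F -> v != 0 -> F.@[v 0] = 0 ->
  \dim (lker (linfun (diff_at F v))) = 3%N.
Proof.
move=> [_ smF] v0 Fv; have [i hi] := smF v v0 Fv.
have := limg_ker_dim (linfun (diff_at F v)) fullv.
rewrite capfv dimvf /dim /=.
suff -> : \dim (linfun (diff_at F v) @: fullv) = 1%N.
  by rewrite mul1n => /eqP; rewrite addn1 eqSS => /eqP.
apply/eqP; rewrite eqn_leq; apply/andP; split.
  by apply: leq_trans (dimvS (subvf _)) _; rewrite dimvf.
rewrite lt0n dimv_eq0; apply: contraNneq hi => h0.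
rewrite -diff_at_delta.
have := memv_img (linfun (diff_at F v)) (memvf (delta_mx 0 i)).
by rewrite h0 memv0 lfunE.
Qed.

Lemma line_eq_span (R : realType) (l : proj_line R) (v x : 'rV[R[i]]_4) :
  v \in sval l -> x \in sval l -> v != 0 -> x \notin <[v]>%VS ->
  sval l = (<[v]> + <[x]>)%VS.
Proof.
move=> vl xl v0 xv; apply/esym/eqP; rewrite eqEdim subv_add -!memvE vl xl /=.
have /eqP -> := svalP l; rewrite dimv_disjoint_sum ?dim_vline ?v0.
  by case: eqP xv => // ->; rewrite mem0v.
apply/eqP; rewrite -subv0; apply/subvP => y /memv_capP[/vlineP[c ->] /vlineP[e E]].
rewrite memv0; have [e0|e0] := eqVneq e 0; first by rewrite E e0 scale0r.
case/negP: xv; apply/vlineP; exists (e^-1 * c).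
by rewrite -scalerA E scalerA mulVf ?scale1r.
Qed.

Lemma line_notin (R : realType) (l m : proj_line R) :
  l != m -> exists2 x, x \in sval l & x \notin sval m.
Proof.
move=> lm; apply: memvNP; apply: contraNN lm => h.
apply/eqP/val_inj/eqP; rewrite eqEdim h.
by have /eqP -> := svalP l; have /eqP -> := svalP m.
Qed.

Lemma lines_through_point_le (R : realType) d (F : {mpoly R[i][4]})
    (p : proj_point R) (s : seq (proj_line R)) :
  (2 <= d)%N -> smooth_surface d F -> uniq s ->
  (forall l, l \in s -> vanishes F (sval l) /\ incident p l) ->
  (size s <= d)%N.
Proof.
move=> d2 smF us hs; rewrite leqNgt; apply/negP => sd.
have [v0 pE] : vpick (sval p) != 0 /\ sval p = <[vpick (sval p)]>%VS.
  have dp := svalP p; rewrite vpick0 -dimv_eq0 (eqP dp); split => //.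
  apply/esym/eqP; rewrite eqEdim -memvE memv_pick (eqP dp) dim_vline.
  by rewrite vpick0 -dimv_eq0 (eqP dp).
move: (vpick _) v0 pE => v v0 pE.
have vl l : l \in s -> v \in sval l.
  by move=> /hs[_]; rewrite /incident pE -memvE.
case: s us hs sd vl => [//|l1 s] /= /andP[l1s us] hs; rewrite ltnS => sd vl.
have [Fl1 _] := hs l1 (mem_head _ _).
have vl1 := vl l1 (mem_head _ _).
have dimT := dim_tangent smF v0 (Fl1 v vl1).
set T := lker _ in dimT.
have lT l : l \in l1 :: s -> (sval l <= T)%VS.
  move=> ls; apply/subvP => x xl; rewrite memv_ker lfunE /=.
  by rewrite (diff_at_vanishes (proj1 (hs l ls))) ?vl.
have [b bT bl1] : exists2 b, b \in T & b \notin sval l1.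
  apply: memvNP; apply: contraL (isT) => /dimvS.
  by rewrite dimT (eqP (svalP l1)).
have [a al1 av] : exists2 a, a \in sval l1 & a \notin <[v]>%VS.
  apply: memvNP; apply: contraL (isT) => /dimvS.
  by rewrite (eqP (svalP l1)) dim_vline v0.
have l1E := line_eq_span vl1 al1 v0 av.
have TE : T = (sval l1 + <[b]>)%VS.
  apply/esym/eqP; rewrite eqEdim subv_add lT ?mem_head //= -memvE bT dimT.
  rewrite dimv_disjoint_sum ?(eqP (svalP l1)) ?dim_vline.
    by case: eqP bl1 => // ->; rewrite mem0v.
  apply/eqP; rewrite -subv0; apply/subvP => y /memv_capP[yl /vlineP[e E]].
  rewrite memv0; have [e0|e0] := eqVneq e 0; first by rewrite E e0 scale0r.
  case/negP: bl1; rewrite -[b]scale1r -(mulVf e0) -scalerA -E.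
  by rewrite memvZ.
have ex_t l : l \in s -> exists t, b + t *: a \in sval l.
  move=> ls; have ll1 : l != l1 by apply: contraNneq l1s => <-.
  have [x xl xl1] := line_notin ll1.
  have /memv_addP[y yl1 [z /vlineP[c zE] xE]] : x \in (sval l1 + <[b]>)%VS.
    by rewrite -TE (subvP (lT l _)) // inE ls orbT.
  have c0 : c != 0.
    by apply: contraNneq xl1 => c0; rewrite xE zE c0 scale0r addr0.
  move: yl1; rewrite l1E => /memv_addP[_ /vlineP[e ->] [_ /vlineP[t ->] yE]].
  exists (c^-1 * t); suff -> : b + (c^-1 * t) *: a = c^-1 *: (x - e *: v).
    by rewrite memvZ // memvB // memvZ // vl // inE ls orbT.
  by rewrite xE yE zE addrAC [e *: v + _]addrC addrK scalerDr !scalerA mulVf // scale1r addrC.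
pose t (l : proj_line R) := xget 0 [set t | b + t *: a \in sval l]%classic.
have tP l (ls : l \in s) : b + t l *: a \in sval l by exact: xgetPex (ex_t l ls).
have t_inj : {in s &, injective t}.
  move=> l m ls ms tE.
  have btv : b + t l *: a \notin <[v]>%VS.
    apply: contraNN bl1 => /vlineP[e hb].
    have -> : b = e *: v - t l *: a by rewrite -hb addrK.
    by rewrite memvB ?memvZ.
  apply: val_inj; rewrite /=.
  rewrite (line_eq_span _ (tP l ls) v0 btv) ?vl ?inE ?ls ?orbT //.
  by rewrite tE in btv *; rewrite (line_eq_span _ (tP m ms) v0 btv) ?vl ?inE ?ms ?orbT.
(* Each of the d other lines contributes the root t l, and the coefficient of
   degree d is F(a) = 0 because a lies on l1. *)
have Q0 e : line_poly (e *: v + b) a F = 0.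
  have [hsize htop] := line_poly_top (e *: v + b) a (proj1 smF).
  apply/eqP; apply: contraT => Q0.
  have := max_poly_roots Q0 (rs := map t s).
  rewrite size_map map_inj_in_uniq // us => /(_ _ isT) h.
  have : (size s < size (line_poly (e *: v + b) a F))%N.
    apply: h; apply/allP => _ /mapP[l ls ->].
    rewrite /root horner_line_poly; apply/eqP.
    have ls' : l \in l1 :: s by rewrite inE ls orbT.
    apply: (proj1 (hs l ls')).
    by rewrite -addrA memvD ?tP // memvZ ?vl.
  suff sQ : (size (line_poly (e *: v + b) a F) <= d)%N.
    by move=> sQ'; have := leq_trans sQ' (leq_trans sQ sd); rewrite ltnn.
  rewrite leqNgt; apply/negP => hd.
  have sE : size (line_poly (e *: v + b) a F) = d.+1 by apply/eqP; rewrite eqn_leq hsize hd.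
  by move/eqP: Q0; apply; apply/eqP; rewrite -lead_coef_eq0 lead_coefE sE /= htop (Fl1 a al1).
apply: (@hyperplane_not_in_smooth R d F T) => // x.
rewrite TE => /memv_addP[y yl1 [_ /vlineP[c ->] ->]].
have [->|c0] := eqVneq c 0; first by rewrite scale0r addr0 Fl1.
move: yl1; rewrite l1E => /memv_addP[_ /vlineP[e ->] [_ /vlineP[u ->] ->]].
have -> : e *: v + u *: a + c *: b = c *: ((c^-1 * e) *: v + b + (c^-1 * u) *: a).
  by rewrite !scalerDr !scalerA !mulrA !divff // !mul1r addrAC.
by rewrite (dhomog_evalZ _ _ (proj1 smF)) -horner_line_poly Q0 horner0 mulr0.
Qed.

Lemma separating_form (K : fieldType) n (W : {vspace 'rV[K]_n}) (v : 'rV[K]_n) :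
  v \notin W -> exists f : {mpoly K[n]},
    [/\ f \is 1.-homog, forall x : 'rV[K]_n, x \in W -> f.@[x 0] = 0 & f.@[v 0] != 0].
Proof.
move=> vW; pose q x := x - projv W x.
have [j hj] : exists j, q v 0 j != 0.
  apply/existsP; apply: contraNT vW; rewrite negb_exists => /forallP q0.
  have /eqP : q v = 0.
    by apply/rowP => j; rewrite [RHS]mxE; apply/eqP; have := q0 j; rewrite negbK.
  by rewrite subr_eq0 => /eqP ->; rewrite memv_proj.
pose f : {mpoly K[n]} := \sum_i q (delta_mx 0 i) 0 j *: 'X_i.
have fE (x : 'rV[K]_n) : f.@[x 0] = q x 0 j.
  rewrite raddf_sum /= {2}(row_sum_delta x) /q linear_sum -sumrB summxE.
  by apply: eq_bigr => i _; rewrite mevalZ mevalXU linearZ -scalerBr [RHS]mxE mulrC.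
exists f; split=> [|x xW|]; last by rewrite fE.
  by apply: rpred_sum => i _; apply: dhomogZ; rewrite dhomogX /= mdeg1.
by rewrite fE /q projv_id // subrr mxE.
Qed.

Lemma zariski_basic_open (R : realType) (U : set (proj_point R)) :
  zariski_basic U -> open U.
Proof.
move=> hU; exists [set U]%classic; last by rewrite bigcup_set1.
by move=> _ ->; exact: (@finI_from1 _ _ _ id).
Qed.

Lemma incident_closed (R : realType) (l : proj_line R) :
  closed [set p | incident p l]%classic.
Proof.
rewrite -openC.
suff -> : (~` [set p | incident p l] =
  \bigcup_(U in [set U | zariski_basic U /\ U `<=` ~` [set p | incident p l]]) U)%classic.
  by apply: bigcup_open => U [hU _]; apply: zariski_basic_open.
apply/seteqP; split=> [p /= /negP /memvNP[v vp vl]|p [U [_ hU] /hU]//].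
have [f [homf fl fv]] := separating_form vl.
exists [set p | ~ vanishes f (sval p)]%classic; last first.
  by move=> h; move/eqP: fv; apply; apply: h.
split; first by exists 1%N, f.
by move=> r /= hr /subvP rl; apply: hr => x /rl; apply: fl.
Qed.

Lemma exists_point (R : realType) (W : {vspace 'rV[R[i]]_4}) :
  W != 0%VS -> exists p : proj_point R, (sval p <= W)%VS.
Proof.
move=> W0; have hd : \dim <[vpick W]> == 1%N by rewrite dim_vline vpick0 W0.
exists (exist (fun p : {vspace 'rV[R[i]]_4} => \dim p == 1%N) _ hd).
by rewrite /= -memvE memv_pick.
Qed.

Lemma line_neq0 (R : realType) (l : proj_line R) : sval l != 0%VS.
Proof. by rewrite -dimv_eq0 (eqP (svalP l)). Qed.

Lemma connected_config_meet (R : realType) (L : {fset proj_line R}) l :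
  connected_config L -> (2 <= #|` L|)%N -> l \in L ->
  exists m p, [/\ m \in L, m != l, incident p l & incident p m].
Proof.
move=> conL L2 lL; apply: contrapT => hn.
pose B := [set p : proj_point R | incident p l]%classic.
pose C := (\bigcup_(m in [set m | m \in (L `\ l)%fset]) [set p | incident p m])%classic.
have disj p : incident p l -> ~ C p.
  move=> pl [m /=]; rewrite in_fsetD1 => /andP[ml mL] pm; apply: hn.
  by exists m, p.
have /fset0Pn [m mL] : (L `\ l)%fset != fset0.
  by rewrite -cardfs_gt0; move: L2; rewrite (cardfsD1 l) lL.
have [p0 p0l] := exists_point (line_neq0 l); have [p1 p1m] := exists_point (line_neq0 m).
have p1C : C p1 by exists m.
suff BE : B = config_support L.
  have : B p1.
    by rewrite BE; exists m => //; move: mL; rewrite in_fsetD1 => /andP[].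
  by move/disj; apply.
have BI (D : set (proj_point R)) :
    (B `<=` D)%classic -> (forall p, D p -> ~ B p -> C p -> False) ->
    B = (config_support L `&` D)%classic.
  move=> BD DB; apply/seteqP; split=> [p pl|p [[k kL pk] Dp]].
    by split; [exists l|apply: BD].
  apply: contrapT => nB; apply: (DB p Dp nB).
  exists k => //=; rewrite in_fsetD1 kL andbT; apply/eqP => kl.
  by apply: nB; rewrite /B /= -kl.
apply: conL; first by exists p0.
  exists (~` C)%classic; last by apply: BI.
  rewrite openC; apply: closed_bigcup => [|k _]; last exact: incident_closed.
  exact: finite_fset.
by exists B; [apply: incident_closed | apply: BI].
Qed.

Lemma mpoly_eq_eval (K : numDomainType) n (f g : {mpoly K[n]}) :
  (forall y : 'rV[K]_n, f.@[y 0] = g.@[y 0]) -> f = g.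
Proof.
move=> fg; apply/eqP; rewrite -subr_eq0; apply/eqP/mpolyP => m; rewrite mcoeff0.
apply: (@coord_vanish_coef0 _ _ pred0) => // y _.
by rewrite mevalB fg subrr.
Qed.

(* (lin_subst T f)(y) = f(y T), so the rows of T become the coordinate vectors. *)
Definition lin_subst (K : comNzRingType) n (T : 'M[K]_n) (f : {mpoly K[n]}) :
    {mpoly K[n]} :=
  f \mPo [tuple \sum_i T i j *: 'X_i | j < n].

HB.instance Definition _ (K : comNzRingType) n (T : 'M[K]_n) :=
  GRing.RMorphism.copy (lin_subst T)
    (comp_mpoly [tuple \sum_i T i j *: 'X_i | j < n]).
HB.instance Definition _ (K : comNzRingType) n (T : 'M[K]_n) :=
  GRing.isScalable.Build K {mpoly K[n]} {mpoly K[n]} *:%R (lin_subst T)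
    (comp_mpoly_is_linear [tuple \sum_i T i j *: 'X_i | j < n]).

Lemma lin_subst_eval (K : comNzRingType) n (T : 'M[K]_n) f (y : 'rV[K]_n) :
  (lin_subst T f).@[y 0] = f.@[(y *m T) 0].
Proof.
rewrite /lin_subst comp_mpoly_meval; apply: meval_eq => j.
rewrite tnth_mktuple raddf_sum mxE; apply: eq_bigr => i _ /=.
by rewrite mevalZ mevalXU mulrC.
Qed.

Lemma lin_substK (K : numFieldType) n (T : 'M[K]_n) :
  T \in unitmx -> cancel (lin_subst T) (lin_subst (invmx T)).
Proof.
by move=> uT f; apply: mpoly_eq_eval => y; rewrite !lin_subst_eval mulmxKV.
Qed.

Lemma lin_substVK (K : numFieldType) n (T : 'M[K]_n) :
  T \in unitmx -> cancel (lin_subst (invmx T)) (lin_subst T).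
Proof.
by move=> uT f; apply: mpoly_eq_eval => y; rewrite !lin_subst_eval mulmxK.
Qed.

Lemma lin_subst_homog (K : comNzRingType) n (T : 'M[K]_n) f d :
  f \is d.-homog -> lin_subst T f \is d.-homog.
Proof.
move=> /dhomogP hf; rewrite /lin_subst comp_mpolyEX big_seq.
apply: rpred_sum => m /hf /= <-; apply: dhomogZ.
rewrite comp_mpolyX mdegE.
apply: (big_ind2 (fun p k => p \is k.-homog)) => [|p k q e hp hq|i _].
- exact: dhomog1.
- exact: dhomogM.
have h1 : tnth [tuple \sum_i T i j *: 'X_i | j < n] i \is 1.-homog.
  rewrite tnth_mktuple; apply: rpred_sum => j _; apply: dhomogZ.
  by rewrite dhomogX /= mdeg1.
by have := dhomogMn (m i) h1; rewrite mul1n.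
Qed.

(* For P upward closed, this is the monomial ideal spanned by P. *)
Definition supp_in (K : comNzRingType) n (P : pred 'X_{1..n}) : set {mpoly K[n]} :=
  [set f | forall m, ~~ P m -> f@_m = 0]%classic.

Lemma supp_in0 (K : comNzRingType) n (P : pred 'X_{1..n}) : supp_in P (0 : {mpoly K[n]}).
Proof. by move=> m _; rewrite mcoeff0. Qed.

Lemma supp_inD (K : comNzRingType) n (P : pred 'X_{1..n}) (f g : {mpoly K[n]}) :
  supp_in P f -> supp_in P g -> supp_in P (f + g).
Proof. by move=> hf hg m Pm; rewrite mcoeffD hf // hg // addr0. Qed.

Lemma supp_inM (K : comNzRingType) n (P Q S : pred 'X_{1..n}) (f g : {mpoly K[n]}) :
  (forall m k, P m -> Q k -> S (m + k)%MM) ->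
  supp_in P f -> supp_in Q g -> supp_in S (f * g).
Proof.
move=> PQ hf hg m Sm; rewrite mcoeffM big1 // => -[k1 k2] /= /eqP mE.
have [Pk|/hf ->] := boolP (P k1); last by rewrite mul0r.
have [Qk|/hg ->] := boolP (Q k2); last by rewrite mulr0.
by have := PQ _ _ Pk Qk; rewrite -mE (negbTE Sm).
Qed.

Lemma subspace_ofE (K : fieldType) (V : vectType K) (A : set V) (U : {vspace V}) :
  (forall v, v \in U <-> A v) -> subspace_of A = U.
Proof.
move=> UA; apply: xget_unique => // W WA; apply/vspaceP => v.
by apply/idP/idP => [/WA /UA|/UA /WA].
Qed.

Lemma supp_in_coef_map (K : numFieldType) (T : 'M[K]_4)
    (P : pred 'X_{1..4}) n (s : seq 'X_{1..4}) :
  T \in unitmx -> uniq s -> (forall m, (m \in s) = (mdeg m == n) && ~~ P m) ->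
  exists psi : 'Hom(dhomog 4 K n, 'rV[K]_(size s)),
    limg psi = fullv /\
    forall f : dhomog 4 K n, f \in lker psi <-> supp_in P (lin_subst T f).
Proof.
move=> uT us hs.
pose psi0 (f : dhomog 4 K n) : 'rV[K]_(size s) :=
  \row_k (lin_subst T f)@_(nth 0%MM s k).
have lin0 : linear psi0.
  by move=> c f g; apply/rowP => k; rewrite !mxE linearP mcoeffD mcoeffZ.
pose lpsi : {linear _ -> _} := HB.pack psi0 (GRing.isLinear.Build _ _ _ _ psi0 lin0).
exists (linfun lpsi); split.
  apply/eqP; rewrite eqEsubv subvf; apply/subvP => r _.
  pose g : {mpoly K[4]} := \sum_(k < size s) r 0 k *: 'X_[nth 0%MM s k].
  have homg : lin_subst (invmx T) g \is n.-homog.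
    apply: lin_subst_homog; apply: rpred_sum => k _; apply: dhomogZ.
    by rewrite dhomogX /=; have := mem_nth 0%MM (ltn_ord k); rewrite hs => /andP[].
  suff -> : r = linfun lpsi (DHomog homg) by rewrite memv_img ?memvf.
  rewrite lfunE; apply/rowP => k; rewrite mxE /= lin_substVK // raddf_sum /=.
  rewrite (bigD1 k) //= big1 => [|j jk]; rewrite mcoeffZ mcoeffX.
    by rewrite eqxx mulr1 addr0.
  by rewrite nth_uniq // (inj_eq val_inj) (negbTE jk) mulr0.
move=> f; rewrite memv_ker lfunE /=; split=> [/eqP h m Pm|h].
  have [/eqP md|md] := eqVneq (mdeg m) n; last first.
    apply: (dhomog_nemf_coeff (mf := mdeg) (d := n)) => //.
    exact/lin_subst_homog/dhomog_is_dhomog.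
  have ms : m \in s by rewrite hs md.
  have ks : (index m s < size s)%N by rewrite index_mem.
  by have := congr1 (fun r : 'rV__ => r 0 (Ordinal ks)) h; rewrite !mxE /= nth_index.
apply/eqP/rowP => k; rewrite !mxE; apply: h.
by have := mem_nth 0%MM (ltn_ord k); rewrite hs => /andP[].
Qed.

(* The monomials of the ideal generated by the X_i with i in A, then those of the
   product of two such ideals. *)
Definition mnm_in_ideal n (A : seq 'I_n) : pred 'X_{1..n} :=
  fun m => has (fun i => m i != 0%N) A.

Definition mnm_in_product n (A B : seq 'I_n) : pred 'X_{1..n} :=
  fun m => has (fun i => has (fun j => (U_(i) + U_(j) <= m)%MM) B) A.

(* In the basis of the rows of T, W is cut out by the coordinates of index in A. *)
Definition coord_subspace (K : fieldType) n (T : 'M[K]_n) (A : seq 'I_n)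
    (W : {vspace 'rV[K]_n}) : Prop :=
  forall y : 'rV[K]_n, (y *m T \in W) = all (fun i => y 0 i == 0) A.

Lemma vanish_coord_subspace (K : numFieldType) n (T : 'M[K]_n) A W
    (f : {mpoly K[n]}) :
  T \in unitmx -> coord_subspace T A W ->
  (forall v : 'rV[K]_n, v \in W -> f.@[v 0] = 0) <->
  supp_in (mnm_in_ideal A) (lin_subst T f).
Proof.
move=> uT cW; split=> [fW m|hf v vW].
  move=> /hasPn hm; apply: (@coord_vanish_coef0 _ _ (mem A)) => [y hy|i /hm].
    by rewrite lin_subst_eval fW // cW; apply/allP => i /hy ->.
  by rewrite negbK => /eqP.
have yE : v = (v *m invmx T) *m T by rewrite mulmxKV.
rewrite yE -lin_subst_eval mevalE big1_seq // => m /andP[_ ms].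
have : mnm_in_ideal A m by apply: contraTT ms => /hf; rewrite mcoeff_msupp => ->; rewrite eqxx.
move=> /hasP[i iA mi].
have := cW (v *m invmx T); rewrite -yE vW => /esym /allP/(_ i iA) /eqP vi.
by rewrite (bigD1 i) //= vi expr0n (negbTE mi) mul0r mulr0.
Qed.

Lemma ideal_gen0 (S : nzRingType) (A : set S) : ideal_gen A 0.
Proof. by exists [::]; rewrite ?big_nil. Qed.

Lemma ideal_genD (S : nzRingType) (A : set S) f g :
  ideal_gen A f -> ideal_gen A g -> ideal_gen A (f + g).
Proof.
move=> [s hs ->] [t ht ->]; exists (s ++ t); rewrite ?big_cat //.
by move=> u; rewrite mem_cat => /orP[/hs|/ht].
Qed.

Lemma ideal_genM (S : nzRingType) (A : set S) a f : A f -> ideal_gen A (a * f).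
Proof.
by move=> Af; exists [:: (a, f)]; rewrite ?big_seq1 // => u; rewrite inE => /eqP ->.
Qed.

Definition vanishing_ideal (K : fieldType) n (W : {vspace 'rV[K]_n}) :
    set {mpoly K[n]} :=
  [set f | forall v : 'rV[K]_n, v \in W -> f.@[v 0] = 0]%classic.

(* sum_ideal of the statement, over an arbitrary field; the two are convertible. *)
Definition mul_add_ideal (K : comNzRingType) n (F : {mpoly K[n]})
    (I J : set {mpoly K[n]}) : set {mpoly K[n]} :=
  ideal_gen ([set h | exists f g, [/\ I f, J g & h = f * g]] `|` [set F])%classic.

Lemma mem_mul_add_ideal (K : numFieldType) n (F : {mpoly K[n]}) (T : 'M[K]_n)
    (A B : seq 'I_n) (l m : {vspace 'rV[K]_n}) (h : {mpoly K[n]}) :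
  T \in unitmx -> coord_subspace T A l -> coord_subspace T B m ->
  mul_add_ideal F (vanishing_ideal l) (vanishing_ideal m) h <->
  exists g, supp_in (mnm_in_product A B) (lin_subst T (h - g * F)).
Proof.
move=> uT cA cB; split=> [[s hs ->]|[g hg]].
  rewrite big_seq; elim/big_ind: _ => [|f f' [g hg] [g' hg']|u /hs[]].
  - by exists 0; rewrite mul0r subr0 rmorph0; apply: supp_in0.
  - exists (g + g'); rewrite mulrDl opprD addrACA rmorphD.
    exact: supp_inD.
  - move=> [a [b [Ia Jb ->]]]; exists 0; rewrite mul0r subr0 !rmorphM.
    have ha := (vanish_coord_subspace a uT cA).1 Ia.
    have hb := (vanish_coord_subspace b uT cB).1 Jb.
    apply: (@supp_inM _ _ predT (mnm_in_product A B)) => [k1 k2 _|//|].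
      move=> /hasP[i iA /hasP[j jB hij]]; apply/hasP; exists i => //.
      by apply/hasP; exists j => //; apply: lepm_trans hij _; apply: lem_addl.
    apply: (supp_inM _ ha hb) => k1 k2 /hasP[i iA hi] /hasP[j jB hj].
    apply/hasP; exists i => //; apply/hasP; exists j => //.
    apply/mnm_lepP => e; rewrite !mnmDE; apply: leq_add.
      by have /mnm_lepP := etrans (lep1mP i k1) hi; apply.
    by have /mnm_lepP := etrans (lep1mP j k2) hj; apply.
  - by move=> /= ->; exists u.1; rewrite subrr rmorph0; apply: supp_in0.
rewrite -[h](subrK (g * F)); apply: ideal_genD; last by apply: ideal_genM; right.
rewrite -[h - _](lin_substK uT) [lin_subst T _]mpolyE raddf_sum /= big_seq.
elim/big_ind: _ => [|f f'|k]; [exact: ideal_gen0|exact: ideal_genD|].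
move: hg; set f := lin_subst T _ => hg ks.
have : mnm_in_product A B k.
  by apply: contraTT ks => /hg; rewrite mcoeff_msupp => ->; rewrite eqxx.
move=> /hasP[i iA /hasP[j jB hij]].
have -> : lin_subst (invmx T) (f@_k *: 'X_[k]) =
    lin_subst (invmx T) (f@_k *: 'X_[k - (U_(i) + U_(j))]) *
    (lin_subst (invmx T) 'X_i * lin_subst (invmx T) 'X_j).
  by rewrite -!rmorphM -scalerAl -!mpolyXD submK.
apply: ideal_genM; left; exists (lin_subst (invmx T) 'X_i), (lin_subst (invmx T) 'X_j).
have van C (W : {vspace _}) c : coord_subspace T C W -> c \in C ->
    forall v : 'rV_n, v \in W -> (lin_subst (invmx T) 'X_c).@[v 0] = 0.
  move=> cC cin; apply/(vanish_coord_subspace _ uT cC).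
  rewrite lin_substVK // => e /hasPn he; rewrite mcoeffX; case: eqP => // eE.
  by have := he c cin; rewrite -eE mnm1E eqxx.
by split=> //; [apply: van cA iA|apply: van cB jB].
Qed.

Lemma product_diff_vanishes (K : numFieldType) n (T : 'M[K]_n)
    (A B : seq 'I_n) (l m : {vspace 'rV[K]_n}) (f : {mpoly K[n]}) (w : 'rV[K]_n) i :
  T \in unitmx -> coord_subspace T A l -> coord_subspace T B m ->
  supp_in (mnm_in_product A B) (lin_subst T f) -> w \in l -> w \in m ->
  f^`M(i).@[w 0] = 0.
Proof.
move=> uT cA cB hf wl wm.
have [s hs ->] : mul_add_ideal 0 (vanishing_ideal l) (vanishing_ideal m) f.
  by apply/(mem_mul_add_ideal _ _ uT cA cB); exists 0; rewrite mul0r subr0.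
rewrite big_seq (raddf_sum (mderiv i)) (raddf_sum (meval (w 0))) big1 //= => u /hs[].
  move=> [a [b [Ia Jb ->]]].
  by rewrite !mderivM !(mevalD, mevalM) (Ia w wl) (Jb w wm) !(mul0r, mulr0, addr0).
by move=> /= ->; rewrite mulr0 mderiv0 meval0.
Qed.

Lemma product_colon (K : numFieldType) n e (F : {mpoly K[n]}) (T : 'M[K]_n)
    (A B : seq 'I_n) (l m : {vspace 'rV[K]_n}) (g : {mpoly K[n]}) :
  T \in unitmx -> coord_subspace T A l -> coord_subspace T B m ->
  (forall v : 'rV[K]_n, v != 0 -> v \in l -> exists i, F^`M(i).@[v 0] != 0) ->
  vanishing_ideal l F -> vanishing_ideal m F ->
  (0 < e)%N -> g \is e.-homog ->
  supp_in (mnm_in_product A B) (lin_subst T (g * F)) <->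
  supp_in (mnm_in_ideal (A ++ B)) (lin_subst T g).
Proof.
move=> uT cA cB smF Fl Fm e0 homg.
have cAB : coord_subspace T (A ++ B) (l :&: m)%VS.
  by move=> y; rewrite memv_cap cA cB all_cat.
split=> [h|h].
  apply/(vanish_coord_subspace _ uT cAB) => w /memv_capP[wl wm].
  have [->|w0] := eqVneq w 0.
    have := dhomog_evalZ 0 (0 : 'rV[K]_n) homg.
    by rewrite scale0r expr0n eqn0Ngt e0 mul0r.
  have [i /negbTE hi] := smF w w0 wl.
  have := product_diff_vanishes i uT cA cB h wl wm.
  rewrite mderivM mevalD !mevalM (Fl w wl) mulr0 add0r => /eqP.
  by rewrite mulf_eq0 hi orbF => /eqP.
have hA := (vanish_coord_subspace F uT cA).1 Fl.
have hB := (vanish_coord_subspace F uT cB).1 Fm.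
have hF : supp_in [pred k | mnm_in_ideal A k && mnm_in_ideal B k] (lin_subst T F).
  by move=> k; rewrite /= negb_and => /orP[/hA|/hB].
rewrite rmorphM; apply: (supp_inM _ h hF) => k1 k2 hk /andP[].
have le1 i (k : 'X_{1..n}) : k i != 0%N -> (U_(i) <= k)%MM by rewrite lep1mP.
have leD (a b a' b' : 'X_{1..n}) : (a <= a')%MM -> (b <= b')%MM -> (a + b <= a' + b')%MM.
  by move=> /mnm_lepP ha /mnm_lepP hb; apply/mnm_lepP => i; rewrite !mnmDE leq_add.
move: hk; rewrite /mnm_in_ideal has_cat => /orP[] /hasP[i iAB hi] /hasP[j jA hj] /hasP[k kB hk].
  apply/hasP; exists i => //; apply/hasP; exists k => //.
  by apply: leD; apply: le1.
apply/hasP; exists j => //; apply/hasP; exists i => //.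
by rewrite addmC; apply: leD; apply: le1.
Qed.

Lemma supp_in_pihomog (K : comNzRingType) n (P : pred 'X_{1..n}) d
    (f : {mpoly K[n]}) :
  supp_in P f -> supp_in P (pihomog mdeg d f).
Proof.
move=> hf m Pm; rewrite pihomogE raddf_sum big1 //= => k _.
rewrite mcoeffZ mcoeffX; case: eqP => [->|_]; last by rewrite mulr0.
by rewrite hf // mul0r.
Qed.

Lemma pihomog_graded (K : comNzRingType) n c
    (Phi : {mpoly K[n]} -> {mpoly K[n]}) (f : {mpoly K[n]}) e :
  {morph Phi : g h / g + h} -> Phi 0 = 0 ->
  (forall j g, g \is j.-homog -> Phi g \is (c + j).-homog) ->
  pihomog mdeg (c + e) (Phi f) = Phi (pihomog mdeg e f).
Proof.
move=> PhiD Phi0 hPhi; pose N := maxn (msize f) e.+1.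
rewrite {1}(@pihomog_partitionE _ _ mdeg N f) ?leq_maxl //.
rewrite (big_morph _ PhiD Phi0) (raddf_sum (pihomog mdeg (c + e))) /=.
have eN : (e < N)%N by rewrite leq_maxr.
rewrite (bigD1 (Ordinal eN)) //= big1 ?addr0 => [|j je].
  by rewrite pihomog_dE //; apply: hPhi; apply: pihomogP.
apply: (pihomog_ne0 (d := (c + j)%N)); last by apply: hPhi; apply: pihomogP.
by rewrite eqn_add2l.
Qed.

Lemma codim_vanishing_ideal (K : numFieldType) (T : 'M[K]_4) (A : seq 'I_4)
    (W : {vspace 'rV[K]_4}) n (s : seq 'X_{1..4}) :
  T \in unitmx -> coord_subspace T A W ->
  uniq s -> (forall m, (m \in s) = (mdeg m == n) && ~~ mnm_in_ideal A m) ->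
  (\dim {: dhomog 4 K n} - \dim (subspace_of
     [set f : dhomog 4 K n | vanishing_ideal W (f : {mpoly K[4]})]%classic) = size s)%N.
Proof.
move=> uT cA us hs; have [psi [im ker]] := supp_in_coef_map uT us hs.
rewrite (subspace_ofE (U := lker psi)) => [|f].
  have := limg_ker_dim psi fullv; rewrite capfv im dimvf /dim /= mul1n => <-.
  by rewrite addKn.
apply: (iff_trans (ker f)); apply: iff_sym.
exact: vanish_coord_subspace.
Qed.

Lemma codim_mul_add_ideal (K : numFieldType) (F : {mpoly K[4]}) (T : 'M[K]_4)
    (A B : seq 'I_4) (l m : {vspace 'rV[K]_4}) d e (s s' : seq 'X_{1..4}) :
  T \in unitmx -> coord_subspace T A l -> coord_subspace T B m ->
  (forall v : 'rV[K]_4, v != 0 -> v \in l -> exists i, F^`M(i).@[v 0] != 0) ->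
  vanishing_ideal l F -> vanishing_ideal m F -> F \is d.-homog -> (0 < e)%N ->
  uniq s -> (forall k, (k \in s) = (mdeg k == (d + e)%N) && ~~ mnm_in_product A B k) ->
  uniq s' -> (forall k, (k \in s') = (mdeg k == e) && ~~ mnm_in_ideal (A ++ B) k) ->
  (\dim {: dhomog 4 K (d + e)} - \dim (subspace_of [set f : dhomog 4 K (d + e) |
      mul_add_ideal F (vanishing_ideal l) (vanishing_ideal m) (f : {mpoly K[4]})]%classic)
   = size s - size s')%N.
Proof.
move=> uT cA cB smF Fl Fm homF e0 us hs us' hs'.
have [psi [im ker]] := supp_in_coef_map uT us hs.
have [psi' [im' ker']] := supp_in_coef_map uT us' hs'.
have homFg (g : dhomog 4 K e) : (g : {mpoly K[4]}) * F \is (d + e).-homog.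
  by rewrite mulrC; apply: dhomogM => //; apply: dhomog_is_dhomog.
pose mu0 (g : dhomog 4 K e) : dhomog 4 K (d + e) := DHomog (homFg g).
have lin0 : linear mu0.
  by move=> c f g; apply: val_inj; rewrite /= mulrDl scalerAl.
pose lmu : {linear _ -> _} := HB.pack mu0 (GRing.isLinear.Build _ _ _ _ mu0 lin0).
pose mu := linfun lmu.
have muE g : (mu g : {mpoly K[4]}) = (g : {mpoly K[4]}) * F by rewrite lfunE.
pose U := (lker psi + limg mu)%VS.
rewrite (subspace_ofE (U := U)) => [|f]; last first.
  apply: iff_trans (iff_sym (mem_mul_add_ideal _ _ uT cA cB)).
  split=> [/memv_addP[k kk [_ /memv_imgP[g _ ->] fE]]|[g hg]].
    by exists (val g); rewrite fE /= muE addrK; apply/ker.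
  have homg : pihomog mdeg e g \is e.-homog by exact: pihomogP.
  rewrite -[f](subrK (mu (DHomog homg))); apply: memv_add; last first.
    by rewrite memv_img ?memvf.
  apply/ker; rewrite /= muE /=.
  have trunc (p : {mpoly K[4]}) : p \is (d + e).-homog ->
      p - pihomog mdeg e g * F = pihomog mdeg (d + e) (p - g * F).
    move=> hp; rewrite (raddfB (pihomog mdeg (d + e))) [X in _ = X - _]pihomog_dE //.
    congr (_ - _); rewrite !(mulrC _ F); apply/esym.
    apply: (@pihomog_graded _ _ d ( *%R F)) => [||j h hj]; rewrite ?mulr0 //.
      exact: mulrDr.
    exact: dhomogM.
  rewrite (trunc f (dhomog_is_dhomog f)).
  rewrite -(pihomog_graded (c := 0) (Phi := lin_subst T)) => [|||j h hj].
  - exact: supp_in_pihomog.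
  - exact: rmorphD.
  - exact: rmorph0.
  exact: lin_subst_homog.
have kerE : lker (psi \o mu)%VF = lker psi'.
  apply/vspaceP => g; apply/idP/idP.
    rewrite memv_ker comp_lfunE -memv_ker => /ker; rewrite /= muE => h.
    apply/ker'; apply/(product_colon uT cA cB smF Fl Fm e0 _) => //.
    exact: dhomog_is_dhomog.
  move=> /ker' h; rewrite memv_ker comp_lfunE -memv_ker; apply/ker; rewrite /= muE.
  apply/(product_colon uT cA cB smF Fl Fm e0 _) => //.
  exact: dhomog_is_dhomog.
have dimV : (\dim (lker psi) + size s)%N = \dim {: dhomog 4 K (d + e)}.
  by have := limg_ker_dim psi fullv; rewrite capfv im [X in (_ + X)%N]dimvf /dim /= mul1n.
have dimE : (\dim (lker psi') + size s')%N = \dim {: dhomog 4 K e}.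
  by have := limg_ker_dim psi' fullv; rewrite capfv im' [X in (_ + X)%N]dimvf /dim /= mul1n.
have dimI : \dim (limg (psi \o mu)%VF) = size s'.
  have := limg_ker_dim (psi \o mu)%VF fullv; rewrite capfv kerE -dimE.
  by move=> /addnI.
have dimU : \dim U = (\dim (lker psi) + size s')%N.
  have := limg_ker_dim psi U; rewrite (capv_idPr (addvSl _ _)) => <-.
  rewrite limgD [X in (X + _)%VS](_ : _ = 0%VS) ?add0v; last first.
    by apply/eqP; rewrite -lkerE.
  by rewrite -limg_comp dimI.
by rewrite -dimV dimU subnDl.
Qed.

Lemma hilbert_function_line (R : realType) (T : 'M[R[i]]_4) (A : seq 'I_4)
    (l : proj_line R) n (s : seq 'X_{1..4}) :
  T \in unitmx -> coord_subspace T A (sval l) ->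
  uniq s -> (forall m, (m \in s) = (mdeg m == n) && ~~ mnm_in_ideal A m) ->
  hilbert_function (line_ideal l) n = size s.
Proof. exact: (@codim_vanishing_ideal R[i]). Qed.

Lemma hilbert_function_sum (R : realType) (F : {mpoly R[i][4]}) (T : 'M[R[i]]_4)
    (A B : seq 'I_4) (l m : proj_line R) d e (s s' : seq 'X_{1..4}) :
  T \in unitmx -> coord_subspace T A (sval l) -> coord_subspace T B (sval m) ->
  smooth_surface d F -> vanishes F (sval l) -> vanishes F (sval m) -> (0 < e)%N ->
  uniq s -> (forall k, (k \in s) = (mdeg k == (d + e)%N) && ~~ mnm_in_product A B k) ->
  uniq s' -> (forall k, (k \in s') = (mdeg k == e) && ~~ mnm_in_ideal (A ++ B) k) ->
  hilbert_function (sum_ideal F (line_ideal l) (line_ideal m)) (d + e) =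
    (size s - size s')%N.
Proof.
move=> uT cA cB [homF smF] Fl Fm e0 us hs us' hs'.
apply: (@codim_mul_add_ideal R[i] F T A B) => // v v0 /Fl Fv.
exact: smF.
Qed.

Lemma hilbert_polyE (R : realType) (I : set {mpoly R[i][4]}) (P : {poly rat}) N :
  (forall n, (N <= n)%N -> P.[n%:R] = (hilbert_function I n)%:R) ->
  hilbert_poly I = P.
Proof.
move=> hP; apply: xget_unique; first by exists N.
move=> Q [M hQ]; apply/eqP; rewrite -subr_eq0; apply: contraT => QP0.
have := max_poly_roots QP0 (rs := [seq k%:R | k <- iota (maxn N M) (size (Q - P))]).
rewrite size_map size_iota ltnn => -> //.
  apply/allP => x /mapP[k]; rewrite mem_iota geq_max => /andP[/andP[Nk Mk] _] ->.
  by rewrite /root hornerD hornerN hQ // hP // subrr.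
by rewrite map_inj_uniq ?iota_uniq //; apply: mulrIn; rewrite oner_neq0.
Qed.

Lemma chi_structE (R : realType) (I : set {mpoly R[i][4]}) N a c :
  (forall n, (N <= n)%N -> hilbert_function I n = (a * n + c)%N) ->
  chi_struct I = c%:R.
Proof.
move=> h; rewrite /chi_struct (@hilbert_polyE _ _ (a%:R *: 'X + c%:R%:P) N).
  by rewrite !hornerE ?mulr0 ?add0r.
by move=> n hn; rewrite (h n hn) !hornerE natrD natrM.
Qed.

Definition mnm4 (a b c d : nat) : 'X_{1..4} := [multinom [tuple a; b; c; d]].

Definition i0 : 'I_4 := @Ordinal 4 0 isT.
Definition i1 : 'I_4 := @Ordinal 4 1 isT.
Definition i2 : 'I_4 := @Ordinal 4 2 isT.
Definition i3 : 'I_4 := @Ordinal 4 3 isT.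

Lemma mnm4E a b c d :
  (mnm4 a b c d i0 = a) * (mnm4 a b c d i1 = b) *
  (mnm4 a b c d i2 = c) * (mnm4 a b c d i3 = d).
Proof. by rewrite /mnm4 !multinomE !(tnth_nth 0%N). Qed.

Lemma mnm4_eta (m : 'X_{1..4}) : m = mnm4 (m i0) (m i1) (m i2) (m i3).
Proof.
apply/mnmP => -[[|[|[|[|//]]]] hi]; rewrite [RHS](_ : _ = m (Ordinal hi)) //;
  by rewrite multinomE (tnth_nth 0%N) /=; congr (m _); apply: val_inj.
Qed.

Lemma mnm4_inj a b c d a' b' c' d' :
  mnm4 a b c d = mnm4 a' b' c' d' -> [/\ a = a', b = b', c = c' & d = d'].
Proof.
by move=> /mnmP h; split;
  [have := h i0|have := h i1|have := h i2|have := h i3]; rewrite !mnm4E.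
Qed.

Lemma mdeg_mnm4 a b c d : mdeg (mnm4 a b c d) = (a + b + c + d)%N.
Proof. by rewrite mdegE !big_ord_recr big_ord0 /= !multinomE !(tnth_nth 0%N). Qed.

Lemma lem_addU n (i j : 'I_n) (m : 'X_{1..n}) :
  (U_(i) + U_(j) <= m)%MM =
  if i == j then (1 < m i)%N else ((0 < m i) && (0 < m j))%N.
Proof.
apply/mnm_lepP/idP => [h|].
  have hi := h i; have hj := h j; move: hi hj; rewrite !mnmDE !mnm1E !eqxx.
  by rewrite [j == i]eq_sym; case: eqP => [->|_] /=; lia.
case: eqP => [->|ij] h k; rewrite mnmDE !mnm1E.
  by case: eqP => [<-|_] //; rewrite addn0.
case: (eqVneq i k) => [<-|_]; first by move: ij h; case: eqP => [->//|_] _; lia.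
by case: eqP => [<-|_] //; lia.
Qed.

(* The monomials of degree n outside (X0, X1), and then outside the products of
   (X0, X1) with (X0, X1), (X0, X2) and (X2, X3) respectively. *)
Definition mnm_line (n : nat) : seq 'X_{1..4} :=
  [seq mnm4 0 0 i (n - i) | i <- iota 0 n.+1].

Definition mnm_self (n : nat) : seq 'X_{1..4} :=
  mnm_line n ++ ([seq mnm4 1 0 i (n.-1 - i) | i <- iota 0 n] ++
                 [seq mnm4 0 1 i (n.-1 - i) | i <- iota 0 n]).

Definition mnm_meet (n : nat) : seq 'X_{1..4} :=
  mnm_line n ++ ([seq mnm4 0 (n - i) 0 i | i <- iota 0 n] ++ [:: mnm4 1 0 0 n.-1]).

Definition mnm_skew (n : nat) : seq 'X_{1..4} :=
  mnm_line n ++ [seq mnm4 i (n - i) 0 0 | i <- iota 0 n.+1].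

Lemma uniq_mnm_line n : uniq (mnm_line n).
Proof.
rewrite map_inj_in_uniq ?iota_uniq // => p q _ _ /mnm4_inj[_ _ ? _]; lia.
Qed.

Lemma mem_mnm_line n m :
  (m \in mnm_line n) = (mdeg m == n) && ~~ mnm_in_ideal [:: i0; i1] m.
Proof.
rewrite (mnm4_eta m); move: (m i0) (m i1) (m i2) (m i3) => a b c d.
rewrite mdeg_mnm4 /mnm_in_ideal /= !mnm4E.
apply/mapP/idP => [[p]|h].
  by rewrite mem_iota => hi /mnm4_inj[-> -> -> ->]; lia.
by exists c; [rewrite mem_iota|congr mnm4]; lia.
Qed.

Lemma uniq_mnm_self n : uniq (mnm_self n).
Proof.
rewrite !cat_uniq uniq_mnm_line !map_inj_in_uniq ?iota_uniq //=; first last.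
- by move=> p q _ _ /mnm4_inj[_ _ ? _]; lia.
- by move=> p q _ _ /mnm4_inj[_ _ ? _]; lia.
rewrite andbT; apply/andP; split; apply/hasPn => x.
  rewrite mem_cat => /orP[] /mapP[p _ ->]; apply/mapP => -[q _ /mnm4_inj[]]; lia.
move=> /mapP[p _ ->]; apply/mapP => -[q _ /mnm4_inj[]]; lia.
Qed.

Lemma mem_mnm_self n m :
  (m \in mnm_self n) =
  (mdeg m == n) && ~~ mnm_in_product [:: i0; i1] [:: i0; i1] m.
Proof.
rewrite !mem_cat mem_mnm_line (mnm4_eta m).
move: (m i0) (m i1) (m i2) (m i3) => a b c d.
rewrite mdeg_mnm4 /mnm_in_ideal /mnm_in_product /= !lem_addU /= !mnm4E.
apply/idP/idP => [|h].
  move=> /or3P[|/mapP[p]|/mapP[p]]; rewrite ?mem_iota; first lia.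
    by move=> hi /mnm4_inj[-> -> -> ->]; lia.
  by move=> hi /mnm4_inj[-> -> -> ->]; lia.
have [ab|] := boolP ((a == 0%N) && (b == 0%N)); first by apply/or3P; constructor 1; lia.
have [b0|b0] := boolP (b == 0%N) => ab; apply/or3P.
  by constructor 2; apply/mapP; exists c; [rewrite mem_iota|congr mnm4]; lia.
by constructor 3; apply/mapP; exists c; [rewrite mem_iota|congr mnm4]; lia.
Qed.

Lemma uniq_mnm_meet n : uniq (mnm_meet n).
Proof.
rewrite !cat_uniq uniq_mnm_line !map_inj_in_uniq ?iota_uniq //=; last first.
  by move=> p q _ _ /mnm4_inj[_ ? _ ?]; lia.
rewrite orbF !andbT; apply/andP; split.
  apply/hasPn => x; rewrite mem_cat inE => /orP[/mapP[p]|/eqP ->].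
    by rewrite mem_iota => hi ->; apply/mapP => -[q _ /mnm4_inj[]]; lia.
  by apply/mapP => -[q _ /mnm4_inj[]]; lia.
by apply/mapP => -[q _ /mnm4_inj[]]; lia.
Qed.

Lemma mem_mnm_meet n m : (0 < n)%N ->
  (m \in mnm_meet n) =
  (mdeg m == n) && ~~ mnm_in_product [:: i0; i1] [:: i0; i2] m.
Proof.
move=> n0; rewrite !mem_cat mem_mnm_line inE (mnm4_eta m).
move: (m i0) (m i1) (m i2) (m i3) => a b c d.
rewrite mdeg_mnm4 /mnm_in_ideal /mnm_in_product /= !lem_addU /= !mnm4E.
apply/idP/idP => [|h].
  move=> /or3P[|/mapP[p]|/eqP/mnm4_inj[-> -> -> ->]]; rewrite ?mem_iota; first lia.
    by move=> hi /mnm4_inj[-> -> -> ->]; lia.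
  lia.
have [ab|] := boolP ((a == 0%N) && (b == 0%N)); first by apply/or3P; constructor 1; lia.
have [a0|a0] := boolP (a == 0%N) => ab; apply/or3P.
  by constructor 2; apply/mapP; exists d; [rewrite mem_iota|congr mnm4]; lia.
by constructor 3; apply/eqP; congr mnm4; lia.
Qed.

Lemma uniq_mnm_skew n : (0 < n)%N -> uniq (mnm_skew n).
Proof.
move=> n0; rewrite cat_uniq uniq_mnm_line map_inj_in_uniq ?iota_uniq //; last first.
  by move=> p q _ _ /mnm4_inj[? _ _ _]; lia.
rewrite andbT; apply/hasPn => x /mapP[p]; rewrite mem_iota => hi ->.
by apply/mapP => -[q _ /mnm4_inj[]]; lia.
Qed.

Lemma mem_mnm_skew n m : (0 < n)%N ->
  (m \in mnm_skew n) =
  (mdeg m == n) && ~~ mnm_in_product [:: i0; i1] [:: i2; i3] m.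
Proof.
move=> n0; rewrite mem_cat mem_mnm_line; set s := map _ _; rewrite (mnm4_eta m).
move: (m i0) (m i1) (m i2) (m i3) => a b c d.
rewrite mdeg_mnm4 /mnm_in_ideal /mnm_in_product /= !lem_addU /= !mnm4E {}/s.
apply/idP/idP => [|h].
  by move=> /orP[|/mapP[p]]; rewrite ?mem_iota; [lia|move=> hi /mnm4_inj[-> -> -> ->]; lia].
have [ab|ab] := boolP ((a == 0%N) && (b == 0%N)); apply/orP.
  by left; lia.
by right; apply/mapP; exists a; [rewrite mem_iota|congr mnm4]; lia.
Qed.

Lemma chi_struct_line_coord (R : realType) (T : 'M[R[i]]_4) (l : proj_line R) :
  T \in unitmx -> coord_subspace T [:: i0; i1] (sval l) ->
  chi_struct (line_ideal l) = 1.
Proof.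
move=> uT cT; rewrite (@chi_structE _ _ 0 1 1) // => n _.
rewrite (hilbert_function_line uT cT (uniq_mnm_line n)) => [|m].
  by rewrite size_map size_iota mul1n addn1.
exact: mem_mnm_line.
Qed.

Lemma chi_struct_self_coord (R : realType) (F : {mpoly R[i][4]}) d
    (l m : proj_line R) (T : 'M[R[i]]_4) :
  smooth_surface d F -> vanishes F (sval l) -> vanishes F (sval m) ->
  T \in unitmx -> coord_subspace T [:: i0; i1] (sval l) ->
  coord_subspace T [:: i0; i1] (sval m) ->
  chi_struct (sum_ideal F (line_ideal l) (line_ideal m)) = d%:R.
Proof.
move=> smF Fl Fm uT cl cm; apply: (@chi_structE _ _ d.+1 2) => n dn.
have -> : n = (d + (n - d))%N by lia.
rewrite (hilbert_function_sum (s := mnm_self (d + (n - d)))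
  (s' := mnm_line (n - d)) uT cl cm smF Fl Fm) => [|||k||k].
- by rewrite !(size_cat, size_map, size_iota); lia.
- by lia.
- exact: uniq_mnm_self.
- exact: mem_mnm_self.
- exact: uniq_mnm_line.
- rewrite mem_mnm_line /mnm_in_ideal; congr (_ && ~~ _).
  by rewrite /=; case: (k i0); case: (k i1).
Qed.

Lemma chi_struct_meet_coord (R : realType) (F : {mpoly R[i][4]}) d
    (l m : proj_line R) (T : 'M[R[i]]_4) :
  smooth_surface d F -> vanishes F (sval l) -> vanishes F (sval m) ->
  T \in unitmx -> coord_subspace T [:: i0; i1] (sval l) ->
  coord_subspace T [:: i0; i2] (sval m) ->
  chi_struct (sum_ideal F (line_ideal l) (line_ideal m)) = 1.
Proof.
move=> smF Fl Fm uT cl cm; rewrite (@chi_structE _ _ d.+1 2 1) // => n dn.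
have -> : n = (d + (n - d))%N by lia.
rewrite (hilbert_function_sum (s := mnm_meet (d + (n - d)))
  (s' := [:: mnm4 0 0 0 (n - d)]) uT cl cm smF Fl Fm) => [|||k||k].
- by rewrite !(size_cat, size_map, size_iota) /=; lia.
- by lia.
- exact: uniq_mnm_meet.
- by apply: mem_mnm_meet; lia.
- by [].
rewrite inE (mnm4_eta k); move: (k i0) (k i1) (k i2) (k i3) => a b c e.
rewrite mdeg_mnm4 /mnm_in_ideal /= !mnm4E.
apply/eqP/idP => [/mnm4_inj[-> -> -> ->]|h]; first lia.
by congr mnm4; lia.
Qed.

Lemma chi_struct_skew_coord (R : realType) (F : {mpoly R[i][4]}) d
    (l m : proj_line R) (T : 'M[R[i]]_4) :
  smooth_surface d F -> vanishes F (sval l) -> vanishes F (sval m) ->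
  T \in unitmx -> coord_subspace T [:: i0; i1] (sval l) ->
  coord_subspace T [:: i2; i3] (sval m) ->
  chi_struct (sum_ideal F (line_ideal l) (line_ideal m)) = 2.
Proof.
move=> smF Fl Fm uT cl cm; apply: (@chi_structE _ _ d.+1 2 2) => n dn.
have -> : n = (d + (n - d))%N by lia.
rewrite (hilbert_function_sum (s := mnm_skew (d + (n - d)))
  (s' := [::]) uT cl cm smF Fl Fm) => [|||k||k].
- by rewrite !(size_cat, size_map, size_iota) /=; lia.
- by lia.
- by apply: uniq_mnm_skew; lia.
- by apply: mem_mnm_skew; lia.
- by [].
rewrite (mnm4_eta k); move: (k i0) (k i1) (k i2) (k i3) => a b c e.
by rewrite mdeg_mnm4 /mnm_in_ideal /= !mnm4E in_nil; lia.
Qed.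

Lemma coord_subspace_dim (K : fieldType) n (T : 'M[K]_n) (A : seq 'I_n)
    (W : {vspace 'rV[K]_n}) :
  T \in unitmx -> uniq A -> (forall i, i \notin A -> row i T \in W) ->
  (\dim W + size A)%N = n -> coord_subspace T A W.
Proof.
move=> uT uA rW dW.
pose p0 (v : 'rV[K]_n) : 'rV[K]_(size A) :=
  \row_k (v *m invmx T) 0 (tnth (in_tuple A) k).
have lin0 : linear p0.
  by move=> c u v; apply/rowP => k; rewrite [LHS]mxE mulmxDl -scalemxAl !mxE.
pose lp : {linear _ -> _} := HB.pack p0 (GRing.isLinear.Build _ _ _ _ p0 lin0).
pose p := linfun lp.
have pE v k : p v 0 k = (v *m invmx T) 0 (tnth (in_tuple A) k).
  by rewrite lfunE mxE.
have kerP y : (y *m T \in lker p) = all (fun i => y 0 i == 0) A.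
  rewrite memv_ker; apply/eqP/allP => [h i iA|h].
    have iA' : (index i A < size A)%N by rewrite index_mem.
    have := congr1 (fun r : 'rV__ => r 0 (Ordinal iA')) h.
    by rewrite pE mulmxK // (tnth_nth i) /= nth_index // mxE => ->.
  apply/rowP => k; rewrite pE mulmxK // [RHS]mxE; apply/eqP/h.
  exact: mem_tnth.
have kerW : (lker p <= W)%VS.
  apply/subvP => v; rewrite -[v](mulmxKV uT) kerP => /allP hA.
  rewrite mulmx_sum_row; apply: memv_suml => i _.
  have [iA|iA] := boolP (i \in A); first by rewrite (eqP (hA i iA)) scale0r mem0v.
  by rewrite memvZ // rW.
suff <- : lker p = W by [].
apply/eqP; rewrite eqEdim kerW /=.
have := limg_ker_dim p fullv; rewrite capfv dimvf /dim /= mul1n.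
have : (\dim (limg p) <= size A)%N.
  by apply: leq_trans (dimvS (subvf _)) _; rewrite dimvf /dim /= mul1n.
by move=> h1 h2; rewrite -(leq_add2r (size A)) dW -[X in (X <= _)%N]h2 leq_add2l.
Qed.

Definition rows4 (K : fieldType) (x0 x1 x2 x3 : 'rV[K]_4) : 'M[K]_4 :=
  \matrix_i nth 0 [:: x0; x1; x2; x3] i.

Lemma rows4_unit (K : fieldType) (x0 x1 x2 x3 : 'rV[K]_4) :
  x3 != 0 -> x2 \notin <[x3]>%VS -> x1 \notin (<[x3]> + <[x2]>)%VS ->
  x0 \notin (<[x3]> + <[x2]> + <[x1]>)%VS ->
  rows4 x0 x1 x2 x3 \in unitmx.
Proof.
move=> h3 h2 h1 h0.
have /freeP fX : free [tuple x0; x1; x2; x3].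
  rewrite !free_cons !span_cons span_nil addv0 nil_free andbT memv0 h3 andbT h2 andbT.
  by rewrite [(<[x2]> + _)%VS]addvC h1 addvC h0.
rewrite -row_free_unit -kermx_eq0; apply/eqP/row_matrixP => i.
rewrite row0; apply/rowP => j; rewrite [RHS]mxE.
apply: (fX (fun j => row i (kermx (rows4 x0 x1 x2 x3)) 0 j)).
have := congr1 (row i) (mulmx_ker (rows4 x0 x1 x2 x3)).
rewrite row_mul row0 mulmx_sum_row => h; rewrite -[RHS]h.
by apply: eq_bigr => k _; rewrite /rows4 rowK.
Qed.

Lemma line_point_complement (R : realType) (l : proj_line R) (v : 'rV[R[i]]_4) :
  v \in sval l -> v != 0 ->
  exists2 x, x \in sval l & x \notin <[v]>%VS.
Proof.
move=> vl v0; apply: memvNP; apply: contraL (isT) => /dimvS.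
by rewrite (eqP (svalP l)) dim_vline v0.
Qed.

Lemma row_rows4 (K : fieldType) (x0 x1 x2 x3 : 'rV[K]_4) :
  (row i0 (rows4 x0 x1 x2 x3) = x0) * (row i1 (rows4 x0 x1 x2 x3) = x1) *
  (row i2 (rows4 x0 x1 x2 x3) = x2) * (row i3 (rows4 x0 x1 x2 x3) = x3).
Proof. by rewrite /rows4 !rowK. Qed.

Lemma coord_line (R : realType) (T : 'M[R[i]]_4) (A : seq 'I_4) (l : proj_line R) :
  T \in unitmx -> uniq A -> size A = 2%N ->
  (forall i, i \notin A -> row i T \in sval l) -> coord_subspace T A (sval l).
Proof.
by move=> uT uA sA h; apply: coord_subspace_dim => //; rewrite sA (eqP (svalP l)).
Qed.

Lemma ord4P (P : 'I_4 -> Prop) : P i0 -> P i1 -> P i2 -> P i3 -> forall i, P i.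
Proof.
move=> h0 h1 h2 h3 i.
have : i \in [:: i0; i1; i2; i3] by case: i => -[|[|[|[|]]]].
by rewrite !inE => /or4P[] /eqP ->.
Qed.

Lemma exists_notin (R : realType) (W : {vspace 'rV[R[i]]_4}) :
  (\dim W < 4)%N -> exists x, x \notin W.
Proof.
move=> dW; have [|x _ xW] := @memvNP _ _ fullv W; last by exists x.
by apply: contraL dW => /dimvS; rewrite dimvf /dim /= -leqNgt.
Qed.

Lemma dim_addv_line (K : fieldType) (V : vectType K) (W : {vspace V}) x :
  (\dim (W + <[x]>) <= (\dim W).+1)%N.
Proof.
apply: leq_trans (dimv_add_leqif W <[x]>%VS) _; rewrite dim_vline -addn1 leq_add2l.
by case: (x != 0).
Qed.

Lemma frame_line (R : realType) (l : proj_line R) (x0 x1 x2 x3 : 'rV[R[i]]_4) :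
  x3 \in sval l -> x3 != 0 -> x2 \in sval l -> x2 \notin <[x3]>%VS ->
  x1 \notin sval l -> x0 \notin (sval l + <[x1]>)%VS ->
  rows4 x0 x1 x2 x3 \in unitmx /\
  coord_subspace (rows4 x0 x1 x2 x3) [:: i0; i1] (sval l).
Proof.
move=> h3 n3 h2 n2 n1 n0; have lE := line_eq_span h3 h2 n3 n2.
have uT : rows4 x0 x1 x2 x3 \in unitmx by apply: rows4_unit; rewrite -?lE.
split=> //; apply: coord_line => //.
by apply: ord4P; rewrite // row_rows4.
Qed.

Lemma line_frame (R : realType) (l : proj_line R) :
  exists T : 'M[R[i]]_4, T \in unitmx /\ coord_subspace T [:: i0; i1] (sval l).
Proof.
have n3 : vpick (sval l) != 0 by rewrite vpick0 line_neq0.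
have [x2 h2 n2] := line_point_complement (memv_pick _) n3.
have [x1 n1] : exists x, x \notin sval l by apply: exists_notin; rewrite (eqP (svalP l)).
have [x0 n0] : exists x, x \notin (sval l + <[x1]>)%VS.
  by apply: exists_notin; rewrite (leq_ltn_trans (dim_addv_line _ _)) // (eqP (svalP l)).
exists (rows4 x0 x1 x2 (vpick (sval l))).
exact: (frame_line (memv_pick _) n3 h2 n2 n1 n0).
Qed.

Lemma chi_struct_line (R : realType) (l : proj_line R) :
  chi_struct (line_ideal l) = 1.
Proof. by have [T [uT cT]] := line_frame l; apply: chi_struct_line_coord cT. Qed.

Lemma curve_int_lines (R : realType) (F : {mpoly R[i][4]}) (l m : proj_line R) :
  curve_int F (line_ideal l) (line_ideal m) =
  2 - chi_struct (sum_ideal F (line_ideal l) (line_ideal m)).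
Proof. by rewrite /curve_int /chi_minus !chi_struct_line; ring. Qed.

Lemma curve_int_self (R : realType) d (F : {mpoly R[i][4]}) (l : proj_line R) :
  smooth_surface d F -> vanishes F (sval l) ->
  curve_int F (line_ideal l) (line_ideal l) = 2 - d%:R.
Proof.
move=> smF Fl; have [T [uT cT]] := line_frame l.
by rewrite curve_int_lines (chi_struct_self_coord smF Fl Fl uT cT cT).
Qed.

Lemma curve_int_meet (R : realType) d (F : {mpoly R[i][4]}) (l m : proj_line R)
    (p : proj_point R) :
  smooth_surface d F -> vanishes F (sval l) -> vanishes F (sval m) ->
  l != m -> incident p l -> incident p m ->
  curve_int F (line_ideal l) (line_ideal m) = 1.
Proof.
move=> smF Fl Fm lm pl pm; set x3 := vpick (sval p).
have n3 : x3 != 0 by rewrite vpick0 -dimv_eq0 (eqP (svalP p)).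
have l3 : x3 \in sval l by apply: (subvP pl); apply: memv_pick.
have m3 : x3 \in sval m by apply: (subvP pm); apply: memv_pick.
have [x2 l2 n2] := line_point_complement l3 n3.
have [x1 m1 n1] : exists2 x, x \in sval m & x \notin sval l.
  by apply: line_notin; rewrite eq_sym.
have [x0 n0] : exists x, x \notin (sval l + <[x1]>)%VS.
  by apply: exists_notin; rewrite (leq_ltn_trans (dim_addv_line _ _)) // (eqP (svalP l)).
have [uT cl] := frame_line l3 n3 l2 n2 n1 n0.
have cm : coord_subspace (rows4 x0 x1 x2 x3) [:: i0; i2] (sval m).
  by apply: coord_line => //; apply: ord4P; rewrite // row_rows4.
by rewrite curve_int_lines (chi_struct_meet_coord smF Fl Fm uT cl cm).
Qed.

Lemma curve_int_skew (R : realType) d (F : {mpoly R[i][4]}) (l m : proj_line R) :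
  smooth_surface d F -> vanishes F (sval l) -> vanishes F (sval m) ->
  (forall p, incident p l -> ~~ incident p m) ->
  curve_int F (line_ideal l) (line_ideal m) = 0.
Proof.
move=> smF Fl Fm lm.
have cap0 : (sval l :&: sval m)%VS = 0%VS.
  apply/eqP; apply: contraT => /exists_point[p]; rewrite subv_cap => /andP[pl pm].
  by have := lm p pl; rewrite /incident pm.
have n3 : vpick (sval l) != 0 by rewrite vpick0 line_neq0.
have [x2 l2 n2] := line_point_complement (memv_pick _) n3.
have n1 : vpick (sval m) != 0 by rewrite vpick0 line_neq0.
have l1 : vpick (sval m) \notin sval l.
  by apply: contra n1 => h; rewrite -memv0 -cap0 memv_cap h memv_pick.
have [x0 m0 n0] : exists2 x, x \in sval m & x \notin (sval l + <[vpick (sval m)]>)%VS.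
  apply: memvNP; apply: contraL (isT) => h.
  have : (sval l + sval m <= sval l + <[vpick (sval m)]>)%VS by rewrite subv_add addvSl h.
  move=> /dimvS; rewrite (dimv_disjoint_sum cap0) (eqP (svalP l)) (eqP (svalP m)) => h4.
  by have := leq_trans h4 (dim_addv_line _ _); rewrite (eqP (svalP l)).
have [uT cl] := frame_line (memv_pick _) n3 l2 n2 l1 n0.
have cm : coord_subspace (rows4 x0 (vpick (sval m)) x2 (vpick (sval l))) [:: i2; i3] (sval m).
  by apply: coord_line => //; apply: ord4P; rewrite // row_rows4 // memv_pick.
by rewrite curve_int_lines (chi_struct_skew_coord smF Fl Fm uT cl cm) subrr.
Qed.

Lemma config_divisor_coeff (R : realType) (L : {fset proj_line R}) l :
  coeff l (config_divisor L) = (l \in L)%:R.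
Proof.
rewrite /config_divisor raddf_sum /=.
under eq_bigr do rewrite coeffU mul1r.
have [lL|lL] := boolP (l \in L).
  rewrite (bigD1_seq l) ?fset_uniq //= eqxx big1 ?addr0 // => m /negbTE ml.
  by rewrite ml.
rewrite big1_seq // => m /andP[_ mL]; case: eqP => // ml.
by rewrite -ml mL in lL.
Qed.

Lemma intersection_number_config (R : realType) (F : {mpoly R[i][4]})
    (L : {fset proj_line R}) :
  intersection_number F (config_divisor L) (config_divisor L) =
  \sum_(l <- L) \sum_(m <- L) curve_int F (line_ideal l) (line_ideal m).
Proof.
have domL : perm_eq (dom (config_divisor L)) L.
  apply: uniq_perm; rewrite ?uniq_dom ?fset_uniq // => l.
  by rewrite mem_dom config_divisor_coeff; case: (l \in L).
rewrite /intersection_number (perm_big _ domL) /= big_seq [RHS]big_seq.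
apply: eq_bigr => l lL; rewrite (perm_big _ domL) /= big_seq [RHS]big_seq.
by apply: eq_bigr => m mL; rewrite !config_divisor_coeff lL mL mulr1 mul1r.
Qed.

Definition mult (R : realType) (L : {fset proj_line R}) (p : proj_point R) : nat :=
  #|` [fset l in L | incident p l]%fset|.

Definition multiple_points (R : realType) (L : {fset proj_line R}) :
    {fset proj_point R} :=
  fset_set [set p | 2 <= mult L p]%N%classic.

Lemma card_fset_cond (I : choiceType) (A : {fset I}) (P : pred I) :
  #|` [fset i in A | P i]%fset| = (\sum_(i <- A) P i)%N.
Proof.
rewrite card_fset_sum1 -big_fset_condE big_mkcond.
by apply: eq_bigr => j _; case: (P j).
Qed.

Lemma two_lines_point (R : realType) (l m : proj_line R) (p q : proj_point R) :
  l != m -> incident p l -> incident p m -> incident q l -> incident q m -> p = q.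
Proof.
move=> lm pl pm ql qm.
have dcap : (\dim (sval l :&: sval m) <= 1)%N.
  have [x xl xm] := line_notin lm.
  suff : (\dim (sval l :&: sval m) < \dim (sval l))%N by rewrite (eqP (svalP l)) ltnS.
  rewrite ltn_neqAle dimvS ?capvSl // andbT.
  apply: contra xm => /eqP dE.
  have /eqP capE : (sval l :&: sval m == sval l)%VS by rewrite eqEdim capvSl dE leqnn.
  by move: xl; rewrite -capE memv_cap => /andP[].
have ptE (r : proj_point R) : incident r l -> incident r m -> sval r = (sval l :&: sval m)%VS.
  move=> rl rm; apply/eqP; rewrite eqEdim subv_cap; apply/andP; split; first exact/andP.
  by rewrite (eqP (svalP r)).
by apply: val_inj; rewrite /= !ptE.
Qed.

Lemma multP (R : realType) (L : {fset proj_line R}) p :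
  reflect (exists l m, [/\ l \in L, m \in L, l != m, incident p l & incident p m])
    (2 <= mult L p)%N.
Proof.
have memS l : (l \in [fset l in L | incident p l]%fset) = (l \in L) && incident p l.
  by rewrite !inE.
apply: (iffP idP) => [h|[l [m [lL mL lm pl pm]]]]; last first.
  rewrite /mult (cardfsD1 l) memS lL pl (cardfsD1 m) in_fsetD1 memS mL pm.
  by rewrite eq_sym lm.
have /fset0Pn[l lS] : [fset l in L | incident p l]%fset != fset0.
  by rewrite -cardfs_gt0; apply: ltn_trans h.
have /fset0Pn[m] : ([fset l in L | incident p l] `\ l)%fset != fset0.
  by rewrite -cardfs_gt0; move: h; rewrite /mult (cardfsD1 l) lS.
rewrite in_fsetD1 memS => /and3P[ml mL pm]; move: lS; rewrite memS => /andP[lL pl].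
by exists l, m; rewrite eq_sym.
Qed.

Lemma multiple_points_finite (R : realType) (L : {fset proj_line R}) :
  finite_set [set p | 2 <= mult L p]%N%classic.
Proof.
apply: (@sub_finite_set _ _ (\bigcup_(l in [set` L]) \bigcup_(m in [set` L])
  [set p | l != m /\ incident p l /\ incident p m])%classic).
  by move=> p /= /multP[l [m [lL mL lm pl pm]]]; exists l => //; exists m.
apply: bigcup_finite => [|l _]; first exact: finite_fset.
apply: bigcup_finite => [|m _]; first exact: finite_fset.
have [[p [lm [pl pm]]]|no] := pselect (exists p, l != m /\ incident p l /\ incident p m).
  apply: (@sub_finite_set _ _ [set p]%classic) => [q /= [_ [ql qm]]|]; last exact: finite_set1.
  exact: (two_lines_point lm).
apply: (@sub_finite_set _ _ set0) => [q h|]; last exact: finite_set0.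
by apply: no; exists q.
Qed.

Lemma mem_multiple_points (R : realType) (L : {fset proj_line R}) p :
  (p \in multiple_points L) = (2 <= mult L p)%N.
Proof.
rewrite /multiple_points in_fset_set; last exact: multiple_points_finite.
by apply/idP/idP; rewrite inE.
Qed.

Lemma t_E (R : realType) (F : {mpoly R[i][4]}) (L : {fset proj_line R}) r :
  line_config F L -> (2 <= r)%N ->
  t_ F L r = (\sum_(p <- multiple_points L) (mult L p == r))%N.
Proof.
move=> FL r2; rewrite /t_ -card_fset_cond; congr #|` _|; apply/fsetP => p.
rewrite in_fset_set; last first.
  apply: sub_finite_set (multiple_points_finite L) => q /= [_].
  by rewrite -/(mult L q) => ->.
rewrite !inE mem_multiple_points; apply/idP/andP.
  by rewrite inE /= -/(mult L p) => -[_ ->].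
move=> [/multP[l [m [lL _ _ pl _]]] /eqP h]; rewrite inE /=; split=> //.
by move=> v vp; apply: (FL l lL); apply: (subvP pl).
Qed.

Lemma sum_t (R : realType) (F : {mpoly R[i][4]}) (L : {fset proj_line R})
    (g : nat -> nat) :
  line_config F L ->
  (\sum_(2 <= r < #|` L|.+1) g r * t_ F L r =
   \sum_(p <- multiple_points L) g (mult L p))%N.
Proof.
move=> FL.
transitivity (\sum_(2 <= r < #|` L|.+1) \sum_(p <- multiple_points L)
   (g r * (mult L p == r)))%N.
  rewrite big_nat [RHS]big_nat; apply: eq_bigr => r /andP[r2 _].
  by rewrite t_E // big_distrr.
rewrite exchange_big /= big_seq [RHS]big_seq; apply: eq_bigr => p.
rewrite mem_multiple_points => p2.
have pk : (mult L p <= #|` L|)%N.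
  by apply: fsubset_leq_card; apply/fsubsetP => l; rewrite !inE => /andP[].
rewrite (bigD1_seq (mult L p)) ?iota_uniq ?mem_index_iota ?p2 //=.
rewrite eqxx muln1 big1 ?addn0 // => r /negbTE; rewrite eq_sym => ->.
by rewrite muln0.
Qed.

Lemma curve_int_config (R : realType) d (F : {mpoly R[i][4]})
    (L : {fset proj_line R}) (l m : proj_line R) :
  smooth_surface d F -> line_config F L -> l \in L -> m \in L ->
  curve_int F (line_ideal l) (line_ideal m) =
  (l == m)%:R * (2 - d%:R - (\sum_(p <- multiple_points L) incident p l)%:R) +
  (\sum_(p <- multiple_points L) incident p l * incident p m)%:R.
Proof.
move=> smF FL lL mL; have [<-|lm] := eqVneq l m.
  rewrite mul1r (curve_int_self smF (FL l lL)).
  suff -> : (\sum_(p <- multiple_points L) incident p l * incident p l =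
          \sum_(p <- multiple_points L) incident p l)%N by rewrite subrK.
  by apply: eq_bigr => p _; case: (incident p l).
rewrite mul0r add0r.
have [[p pl pm]|no] := pselect (exists2 p, incident p l & incident p m).
  rewrite (curve_int_meet smF (FL l lL) (FL m mL) lm pl pm).
  have pM : p \in multiple_points L.
    by rewrite mem_multiple_points; apply/multP; exists l, m.
  rewrite (bigD1_seq p) ?fset_uniq //= pl pm big1 // => q qp.
  case: (boolP (incident q l)) => // ql; case: (boolP (incident q m)) => // qm.
  by rewrite (two_lines_point lm ql qm pl pm) eqxx in qp.
rewrite (curve_int_skew smF (FL l lL) (FL m mL)) => [|p pl].
  rewrite big1 // => p _; case: (boolP (incident p l)) => // pl.
  by case: (boolP (incident p m)) => // pm; case: no; exists p.
by apply/negP => pm; apply: no; exists p.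
Qed.

Lemma config_self_intersection (R : realType) d (F : {mpoly R[i][4]})
    (L : {fset proj_line R}) :
  smooth_surface d F -> line_config F L ->
  intersection_number F (config_divisor L) (config_divisor L) =
  #|` L|%:R * (2 - d%:R) - (\sum_(p <- multiple_points L) mult L p)%:R +
  (\sum_(p <- multiple_points L) mult L p ^ 2)%:R.
Proof.
move=> smF FL; rewrite intersection_number_config.
pose c l : rat := 2 - d%:R - (\sum_(p <- multiple_points L) incident p l)%:R.
pose e l m := (\sum_(p <- multiple_points L) incident p l * incident p m)%N.
transitivity (\sum_(l <- L) (c l + (\sum_(m <- L) e l m)%:R)).
  rewrite big_seq [RHS]big_seq; apply: eq_bigr => l lL.
  transitivity (\sum_(m <- L) ((l == m)%:R * c l + (e l m)%:R)).
    by rewrite big_seq [RHS]big_seq; apply: eq_bigr => m mL; apply: curve_int_config.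
  rewrite big_split natr_sum /=; congr (_ + _).
  rewrite (bigD1_seq l) ?fset_uniq //= eqxx mul1r big1 ?addr0 // => m /negbTE.
  by rewrite eq_sym => ->; rewrite mul0r.
rewrite big_split sumrB big_const_seq count_predT iter_addr_0 -!natr_sum.
congr (_ - _%:R + _%:R); first by rewrite mulr_natl.
  rewrite exchange_big; apply: eq_bigr => p _ /=.
  by rewrite /mult card_fset_cond.
rewrite /e; under eq_bigr do rewrite exchange_big /=.
rewrite exchange_big /=; apply: eq_bigr => p _.
under eq_bigr do rewrite -big_distrr /=.
by rewrite -big_distrl /= /mult card_fset_cond expnS expn1.
Qed.

Lemma lines_le_sum_mult (R : realType) (L : {fset proj_line R}) :
  connected_config L -> (2 <= #|` L|)%N ->
  (#|` L| <= \sum_(p <- multiple_points L) mult L p)%N.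
Proof.
move=> conL L2.
have -> : (\sum_(p <- multiple_points L) mult L p =
    \sum_(l <- L) \sum_(p <- multiple_points L) incident p l)%N.
  rewrite exchange_big; apply: eq_bigr => p _ /=.
  by rewrite /mult card_fset_cond.
rewrite card_fset_sum1 big_seq [leqRHS]big_seq; apply: leq_sum => l lL.
have [m [p [mL ml pl pm]]] := connected_config_meet conL L2 lL.
have pM : p \in multiple_points L.
  by rewrite mem_multiple_points; apply/multP; exists l, m; rewrite eq_sym.
by rewrite (bigD1_seq p) ?fset_uniq //= pl.
Qed.

Lemma mult_le_degree (R : realType) d (F : {mpoly R[i][4]})
    (L : {fset proj_line R}) p :
  (2 <= d)%N -> smooth_surface d F -> line_config F L -> (mult L p <= d)%N.
Proof.
move=> d2 smF FL; apply: (lines_through_point_le (p := p) d2 smF (fset_uniq _)) => l.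
by rewrite !inE => /andP[lL pl]; split; [exact: FL|].
Qed.

Theorem theorem3p2 (R : realType) (d : nat) (F : {mpoly R[i][4]})
    (L : {fset proj_line R}) (hd : (4 <= d)%N) (hX : smooth_surface d F)
    (hL : line_config F L) (hconn : connected_config L)
    (hk : (2 <= #|` L|)%N) :
  - (d%:R * (d%:R - 1)) <= h_constant F L.
Proof.
set M := (\sum_(p <- multiple_points L) mult L p)%N.
set S := (\sum_(p <- multiple_points L) 1)%N.
have kM : (#|` L| <= M)%N by apply: lines_le_sum_mult.
have MS : (M <= d * S)%N.
  rewrite /M /S big_distrr /=; apply: leq_sum => p _; rewrite muln1.
  by apply: mult_le_degree hX hL; apply: leq_trans hd.
have S0 : (0 < S)%N by rewrite lt0n; apply: contraTneq MS => ->; lia.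
have -> : h_constant F L = (#|` L|%:R * (2 - d%:R) - M%:R) / S%:R.
  rewrite /h_constant (config_self_intersection hX hL) -!natr_sum.
  rewrite (sum_t (fun r => r ^ 2)%N hL) addrK.
  by under eq_big_nat do rewrite -[t_ _ _ _]mul1n; rewrite (sum_t (fun=> 1%N) hL).
rewrite ler_pdivlMr ?ltr0n // -subr_ge0.
have d4 : (4 : rat) <= d%:R by rewrite ler_nat.
have : (#|` L|%:R : rat) <= M%:R by rewrite ler_nat.
have : (M%:R : rat) <= d%:R * S%:R by rewrite -natrM ler_nat.
move: (#|` L|%:R : rat) (M%:R : rat) (S%:R : rat) (d%:R : rat) d4 => k m s e e4 ms km.
have h1 : 0 <= (e - 2) * (m - k) by rewrite mulr_ge0 //; lra.
have h2 : 0 <= (e - 1) * (e * s - m) by rewrite mulr_ge0 //; lra.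
lra.
Qed.
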